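(* Let $z\in[0,1]$. Then $z$ is weakly $2$-random if and only if every computable function $f\colon[0,1]\to\mathbb R$ that is differentiable at almost every point (with respect to Lebesgue measure) is differentiable at $z$.
   Context: A Cauchy name for a real $x$ is a sequence of rationals $(q_n)$ with $|q_n-q_{n-1}|\le2^{-n}$ for $n>0$ and $\lim_nq_n=x$; reals and sequences of reals are computable if they have (uniformly) computable Cauchy names. $f\colon[0,1]\to\mathbb R$ is computable if it maps computable sequences of reals in $[0,1]$ to computable sequences of reals, and there is a computable $h\colon\mathbb N\to\mathbb N$ with $|x-y|<2^{-h(n)}\Rightarrow|f(x)-f(y)|<2^{-n}$. An open interval in $[0,1]$ means a set of the form $(a,b)$, $[0,b)$, $(a,1]$ or $[0,1]$ with $0\le a\le b\le1$. A $\Sigma^0_1$ set in $[0,1]$ is a set $\bigcup_kA_k$ where $(A_k)$ is a computable sequence of open intervals in $[0,1]$ with dyadic rational endpoints; a $\Pi^0_2$ set is $\bigcap_m\mathcal G_m$ where the $\mathcal G_m$ are $\Sigma^0_1$ sets uniformly in $m$. A real $z\in[0,1]$ is weakly $2$-random if it belongs to no $\Pi^0_2$ set of Lebesgue measure zero. *)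

(* Defs.v *)
From HB Require Import structures.
From mathcomp Require Import all_boot all_order all_algebra.
From mathcomp Require Import all_classical all_reals all_analysis.

Set Implicit Arguments.
Unset Strict Implicit.
Unset Printing Implicit Defensive.

Import Order.TTheory GRing.Theory Num.Theory.
Import numFieldNormedType.Exports.

Local Open Scope classical_set_scope.
Local Open Scope ring_scope.

(* Programs for the partial mu-recursive functions. The evaluation relation    *)
(* below is partial: a program need not return a value on a given argument     *)
(* list (unbounded search, or too few arguments).                              *)
Inductive murec : Type :=
| MZero
| MSucc
| MProj of nat
| MComp of murec & seq murec
| MPrec of murec & murec
| MMin of murec.

Inductive murec_eval : murec -> seq nat -> nat -> Prop :=
| eval_zero v : murec_eval MZero v 0
| eval_succ x v : murec_eval MSucc (x :: v) x.+1
| eval_proj i v : (i < size v)%N -> murec_eval (MProj i) v (nth 0%N v i)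
| eval_comp c cs v w y :
    murec_evals cs v w -> murec_eval c w y -> murec_eval (MComp c cs) v y
| eval_prec0 c d v y :
    murec_eval c v y -> murec_eval (MPrec c d) (0%N :: v) y
| eval_precS c d n v r y :
    murec_eval (MPrec c d) (n :: v) r -> murec_eval d [:: n, r & v] y ->
    murec_eval (MPrec c d) (n.+1 :: v) y
| eval_min c v n (k : nat -> nat) :
    murec_eval c (n :: v) 0 ->
    (forall m, (m < n)%N -> murec_eval c (m :: v) (k m).+1) ->
    murec_eval (MMin c) v n
with murec_evals : seq murec -> seq nat -> seq nat -> Prop :=
| evals_nil v : murec_evals [::] v [::]
| evals_cons c cs v y w :
    murec_eval c v y -> murec_evals cs v w ->
    murec_evals (c :: cs) v (y :: w).

Definition computable1 (f : nat -> nat) : Prop :=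
  exists c, forall n, murec_eval c [:: n] (f n).

Definition computable2 (f : nat -> nat -> nat) : Prop :=
  exists c, forall m n, murec_eval c [:: m; n] (f m n).

Definition computable_rat2 (q : nat -> nat -> rat) : Prop :=
  exists s a b : nat -> nat -> nat,
    [/\ computable2 s, computable2 a, computable2 b &
        forall k n, q k n = (-1) ^+ s k n * (a k n)%:R / (b k n).+1%:R].

Definition cauchy_name (R : realType) (q : nat -> rat) (x : R) : Prop :=
  (forall n, (0 < n)%N -> `|q n - q n.-1| <= 2 ^- n) /\
  (ratr (q n) : R) @[n --> \oo] --> x.

Definition computable_realseq (R : realType) (x : nat -> R) : Prop :=
  exists q : nat -> nat -> rat,
    computable_rat2 q /\ forall k, cauchy_name (q k) (x k).

(* Functions [0,1] -> R are represented by functions R -> R of which only the  *)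
(* values on [0,1] are ever used.                                              *)
Definition computable_fun01 (R : realType) (f : R -> R) : Prop :=
  (forall x : nat -> R, (forall k, x k \in `[0, 1]) ->
     computable_realseq x -> computable_realseq (fun k => f (x k))) /\
  exists2 h : nat -> nat, computable1 h &
    forall (n : nat) (x y : R), x \in `[0, 1] -> y \in `[0, 1] ->
      `|x - y| < 2 ^- h n -> `|f x - f y| < 2 ^- n.

(* The difference quotient is taken over points of [0,1] only; at 0 and 1 this *)
(* is the one-sided derivative.                                                *)
Definition differentiable01 (R : realType) (f : R -> R) (z : R) : Prop :=
  exists l : R,
    (f y - f z) / (y - z)
      @[y --> within [set y | y \in `[0, 1] /\ y != z] (nbhs z)] --> l.

Definition dyadic (R : realType) (p e : nat) : R := p%:R / 2 ^+ e.

Definition open_interval01 (R : realType) (t : nat) (a b : R) : set R :=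
  match t with
  | 0 => [set` `]a, b[]
  | 1 => [set` `[0, b[]
  | 2 => [set` `]a, 1]]
  | _ => [set` `[0, 1]]
  end.

(* G m = \bigcup_k A m k for a computable double sequence of intervals; A m k  *)
(* is given by its shape t m k and by its endpoints as pairs of a numerator    *)
(* and an exponent of 2.                                                       *)
Definition uniformly_Sigma01 (R : realType) (G : nat -> set R) : Prop :=
  exists t p d q e : nat -> nat -> nat,
    [/\ [/\ computable2 t, computable2 p, computable2 d, computable2 q &
            computable2 e],
        forall m k, [/\ 0 <= dyadic R (p m k) (d m k),
          dyadic R (p m k) (d m k) <= dyadic R (q m k) (e m k) &
          dyadic R (q m k) (e m k) <= 1] &
        forall m, G m = \bigcup_k open_interval01 (t m k)
          (dyadic R (p m k) (d m k)) (dyadic R (q m k) (e m k))].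

Definition Pi02 (R : realType) (S : set R) : Prop :=
  exists2 G : nat -> set R, uniformly_Sigma01 G & S = \bigcap_m G m.

Definition weakly2random (R : realType) (z : R) : Prop :=
  z \in `[0, 1] /\
  forall S : set R, Pi02 S -> lebesgue_measure S = 0%E -> ~ S z.

(* Main.v *)
Require Import Defs.
From HB Require Import structures.
From mathcomp Require Import all_boot all_order all_algebra.
From mathcomp Require Import all_classical all_reals all_analysis.
From mathcomp Require Import zify ring lra.

(**
Non-differentiability of [f] at an interior point [z] means that, for some [k],
there are arbitrarily short pairs of chords straddling [z], with dyadic end
points, whose slopes differ by more than [2^-k].  For fixed [k] this is a Pi02
condition on [z], and it defines a null set when [f] is differentiable almost
everywhere; so a weakly 2-random point avoids it.

Conversely, let [z] lie in a null Pi02 set, the intersection of the [G m].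
Walk down the dyadic cells containing a point [x] and keep a level [m],
initially [0].  When the cell of length [2^-n], fattened by [(n+1) 2^-n], is
seen at stage [n] to be contained in [G m], bet: add to [f] the tent of slope
[+-1] over that cell and increase the level.  If [x] is in all [G m] then
infinitely many tents are added above [x], each changing by one the slope of the
chord over the cell of [x], and [f] is not differentiable at [x].  If [x] is not
in [G m] then only finitely many tents are added above [x]; the later tents
above a point [y] of the same cell as a nondyadic [x] contribute at most [2^-n]
to [f y] where [n] is the depth of the first of them, and [x] lies at distance at
least [(n+1) 2^-n] from [y]: otherwise [x] would belong to the [G m] of its
final level [m], and one more tent would be added above [x].  Hence [f] differs
from an affine function near [x] by [o(|y - x|)].
*)

Set Implicit Arguments.
Unset Strict Implicit.
Unset Printing Implicit Defensive.

Import Order.TTheory GRing.Theory Num.Theory.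
Import numFieldNormedType.Exports.

(** * Computable functions of several arguments *)

Local Open Scope nat_scope.

Definition computablen (k : nat) (f : seq nat -> nat) : Prop :=
  exists c, forall v, size v = k -> murec_eval c v (f v).

Lemma eq_computablen k f g :
  (forall v, size v = k -> f v = g v) -> computablen k f -> computablen k g.
Proof. by move=> fg [c fc]; exists c => v sv; rewrite -fg//; apply: fc. Qed.

Lemma computable1P (h : nat -> nat) :
  computable1 h <-> computablen 1 (fun v => h (nth 0 v 0)).
Proof.
split=> -[c hc]; exists c; last by move=> n; apply: (hc [:: n]).
by move=> [|x [|//]]// _; apply: hc.
Qed.

Lemma computable2P (h : nat -> nat -> nat) :
  computable2 h <-> computablen 2 (fun v => h (nth 0 v 0) (nth 0 v 1)).
Proof.
split=> -[c hc]; exists c; last by move=> m n; apply: (hc [:: m; n]).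
by move=> [|x [|y [|//]]]// _; apply: hc.
Qed.

Lemma computablen_nth k i : i < k -> computablen k (fun v => nth 0 v i).
Proof. by move=> ik; exists (MProj i) => v sv; apply: eval_proj; rewrite sv. Qed.

Lemma murec_evals_map (cs : nat -> murec) (v : seq nat) (f : nat -> nat) s :
  {in s, forall i, murec_eval (cs i) v (f i)} ->
  murec_evals (map cs s) v (map f s).
Proof.
elim: s => [|i s IHs] sf /=; first exact: evals_nil.
apply: evals_cons; first exact/sf/mem_head.
by apply: IHs => j js; apply: sf; rewrite in_cons js orbT.
Qed.

Lemma computablen_comp k n g (fs : nat -> seq nat -> nat) :
  computablen n g -> (forall i, i < n -> computablen k (fs i)) ->
  computablen k (fun v => g (mkseq (fs ^~ v) n)).
Proof.
move=> [d gd] cfs.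
have /choice[cs csE] i : exists c, i < n -> forall v, size v = k ->
    murec_eval c v (fs i v).
  have [/cfs[c fc]|_] := ltnP i n; first by exists c.
  by exists MZero.
exists (MComp d (mkseq cs n)) => v sv.
apply: eval_comp (gd _ _); last by rewrite size_mkseq.
by apply: murec_evals_map => i; rewrite mem_iota => /csE; apply.
Qed.

Lemma computablen_comp1 k (h : nat -> nat) f : computable1 h ->
  computablen k f -> computablen k (fun v => h (f v)).
Proof. by move=> /computable1P ch cf; apply: (computablen_comp (fs := fun=> f) ch). Qed.

Lemma computablen_comp2 k (h : nat -> nat -> nat) f g : computable2 h ->
  computablen k f -> computablen k g -> computablen k (fun v => h (f v) (g v)).
Proof.
move=> /computable2P ch cf cg.
by apply: (computablen_comp (fs := nth f [:: f; g]) ch) => -[|[|]].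
Qed.

Definition computable3 (h : nat -> nat -> nat -> nat) : Prop :=
  computablen 3 (fun v => h (nth 0 v 0) (nth 0 v 1) (nth 0 v 2)).

Lemma computablen_comp3 k (h : nat -> nat -> nat -> nat) f1 f2 f3 : computable3 h ->
  computablen k f1 -> computablen k f2 -> computablen k f3 ->
  computablen k (fun v => h (f1 v) (f2 v) (f3 v)).
Proof.
move=> ch cf1 cf2 cf3.
by apply: (computablen_comp (fs := nth f1 [:: f1; f2; f3]) ch) => -[|[|[|]]].
Qed.

Lemma computablen_succ k f : computablen k f -> computablen k (fun v => (f v).+1).
Proof.
by apply: computablen_comp1; exists MSucc => n; apply: eval_succ.
Qed.

Lemma computablen_cst k n : computablen k (fun=> n).
Proof.
elim: n => [|n IHn]; first by exists MZero => v _; apply: eval_zero.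
exact: computablen_succ IHn.
Qed.

Lemma computablen_nth_drop j k i : j + i < k ->
  computablen k (fun w => nth 0 (drop j w) i).
Proof.
by move=> jik; apply: eq_computablen (computablen_nth jik) => w _; rewrite nth_drop.
Qed.

Lemma computablen_drop j k f :
  computablen k f -> computablen (j + k) (fun w => f (drop j w)).
Proof.
move=> cf; apply: eq_computablen
  (computablen_comp (fs := fun i w => nth 0 (drop j w) i) cf _) => [w sw|i ik].
  by rewrite -[k](addKn j) -sw -size_drop mkseq_nth.
by apply: computablen_nth_drop; rewrite ltn_add2l.
Qed.

#[local] Hint Resolve computablen_cst computablen_succ : computability.
#[local] Hint Extern 1 (computablen _ (fun v => nth _ v _)) =>
  exact: computablen_nth : computability.
#[local] Hint Extern 1 (computablen _ (fun v => nth _ (drop _ v) _)) =>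
  exact: computablen_nth_drop : computability.
#[local] Hint Extern 1 (computablen _ (fun v => _ (drop ?j v))) =>
  by apply: (computablen_drop j) : computability.
#[local] Hint Extern 2 (computablen _ (fun v => ?h _)) =>
  apply: (@computablen_comp1 _ h) : computability.
#[local] Hint Extern 2 (computablen _ (fun v => ?h _ _)) =>
  apply: (@computablen_comp2 _ h) : computability.

Lemma computablen_rec k f g (h : nat -> nat -> seq nat -> nat) :
  computablen k f -> computablen k g ->
  computablen k.+2 (fun w => h (nth 0 w 0) (nth 0 w 1) (drop 2 w)) ->
  computablen k (fun v => nat_rect (fun=> nat) (g v) (fun i r => h i r v) (f v)).
Proof.
move=> [cf fc] [cg gc] [ch hc].
exists (MComp (MPrec cg ch) (cf :: mkseq MProj k)) => v sv.
apply: (@eval_comp _ _ _ (f v :: v)).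
  apply: evals_cons; first exact: fc.
  rewrite -{2}(mkseq_nth 0 v) sv; apply: murec_evals_map => i.
  by rewrite mem_iota -sv; apply: eval_proj.
elim: (f v) => [|i IHi] /=; first by apply: eval_prec0; exact: gc.
apply: eval_precS IHi _.
have := hc [:: i, nat_rect (fun=> nat) (g v) (fun i r => h i r v) i & v].
by rewrite /= drop0 sv; apply.
Qed.

Lemma computablen_add k f g : computablen k f -> computablen k g ->
  computablen k (fun v => f v + g v).
Proof.
move=> cf cg; apply: eq_computablen
  (computablen_rec (h := fun _ r _ => r.+1) cf cg _) => [v _|].
  by elim: (f v) => //= n ->.
by auto with computability.
Qed.
#[local] Hint Resolve computablen_add : computability.

Lemma computablen_pred k f : computablen k f -> computablen k (fun v => (f v).-1).
Proof.
move=> cf; apply: eq_computablen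
  (computablen_rec (h := fun i _ _ => i) cf (computablen_cst k 0) _) => [v _|].
  by case: (f v).
by auto with computability.
Qed.
#[local] Hint Resolve computablen_pred : computability.

Lemma computablen_sub k f g : computablen k f -> computablen k g ->
  computablen k (fun v => f v - g v).
Proof.
move=> cf cg; apply: eq_computablen
  (computablen_rec (h := fun _ r _ => r.-1) cg cf _) => [v _|].
  by elim: (g v) => [|n /= ->]; rewrite ?subn0 ?subnS.
by auto with computability.
Qed.
#[local] Hint Resolve computablen_sub : computability.

Lemma computablen_mul k f g : computablen k f -> computablen k g ->
  computablen k (fun v => f v * g v).
Proof.
move=> cf cg; apply: eq_computablen
  (computablen_rec (h := fun _ r v => g v + r) cf (computablen_cst k 0) _) => [v _|].
  by elim: (f v) => [|n /= ->] //; rewrite mulSn.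
by auto with computability.
Qed.
#[local] Hint Resolve computablen_mul : computability.

Lemma computablen_exp k f g : computablen k f -> computablen k g ->
  computablen k (fun v => f v ^ g v).
Proof.
move=> cf cg; apply: eq_computablen
  (computablen_rec (h := fun _ r v => f v * r) cg (computablen_cst k 1) _) => [v _|].
  by elim: (g v) => [|n /= ->] //; rewrite expnS.
by auto with computability.
Qed.
#[local] Hint Resolve computablen_exp : computability.

Lemma computablen_leq k f g : computablen k f -> computablen k g ->
  computablen k (fun v => f v <= g v : nat).
Proof.
move=> cf cg; apply: (@eq_computablen _ (fun v => 1 - (f v - g v))) => [v _|].
  by rewrite /leq; case: (f v - g v) => // n; rewrite subSS sub0n.
by auto with computability.
Qed.
#[local] Hint Resolve computablen_leq : computability.

Lemma computablen_minn k f g : computablen k f -> computablen k g ->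
  computablen k (fun v => minn (f v) (g v)).
Proof.
move=> cf cg; apply: (@eq_computablen _ (fun v => f v - (f v - g v))) => [v _|].
  by rewrite minnE.
by auto with computability.
Qed.
#[local] Hint Resolve computablen_minn : computability.

Lemma computablen_maxn k f g : computablen k f -> computablen k g ->
  computablen k (fun v => maxn (f v) (g v)).
Proof.
move=> cf cg; apply: (@eq_computablen _ (fun v => f v + (g v - f v))) => [v _|].
  by rewrite maxnE.
by auto with computability.
Qed.
#[local] Hint Resolve computablen_maxn : computability.

Lemma computablen_negb k (a : seq nat -> bool) :
  computablen k (fun v => a v : nat) -> computablen k (fun v => ~~ a v : nat).
Proof.
move=> ca; apply: (@eq_computablen _ (fun v => 1 - a v)) => [v _|].
  by case: (a v).
by auto with computability.
Qed.
#[local] Hint Resolve computablen_negb : computability.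

Lemma computablen_andb k (a b : seq nat -> bool) :
  computablen k (fun v => a v : nat) -> computablen k (fun v => b v : nat) ->
  computablen k (fun v => a v && b v : nat).
Proof.
move=> ca cb; apply: (@eq_computablen _ (fun v => a v * b v)) => [v _|].
  by rewrite mulnb.
by auto with computability.
Qed.
#[local] Hint Resolve computablen_andb : computability.

Lemma computablen_orb k (a b : seq nat -> bool) :
  computablen k (fun v => a v : nat) -> computablen k (fun v => b v : nat) ->
  computablen k (fun v => a v || b v : nat).
Proof.
move=> ca cb; apply: (@eq_computablen _ (fun v => maxn (a v) (b v))) => [v _|].
  by case: (a v) (b v) => [] [].
by auto with computability.
Qed.
#[local] Hint Resolve computablen_orb : computability.

Lemma computablen_odd k f : computablen k f -> computablen k (fun v => odd (f v) : nat).
Proof.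
move=> cf; apply: eq_computablen
  (computablen_rec (h := fun _ r v => 1 - r) cf (computablen_cst k 0) _) => [v _|].
  by elim: (f v) => [|n /= ->] //; case: (odd n).
by auto with computability.
Qed.
#[local] Hint Resolve computablen_odd : computability.

Lemma computablen_if k (a : seq nat -> bool) f g :
  computablen k (fun v => a v : nat) -> computablen k f -> computablen k g ->
  computablen k (fun v => if a v then f v else g v).
Proof.
move=> ca cf cg.
apply: (@eq_computablen _ (fun v => a v * f v + ~~ a v * g v)) => [v _|].
  by case: (a v); rewrite ?mul1n ?mul0n ?addn0.
by auto with computability.
Qed.
#[local] Hint Resolve computablen_if : computability.

Lemma computablen_sum k f (h : nat -> seq nat -> nat) :
  computablen k f -> computablen k.+1 (fun w => h (nth 0 w 0) (drop 1 w)) ->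
  computablen k (fun v => \sum_(i < f v) h i v).
Proof.
move=> cf ch; apply: eq_computablen
  (computablen_rec (h := fun i r v => r + h i v) cf (computablen_cst k 0) _) => [v _|].
  by elim: (f v) => [|m /= ->]; rewrite ?big_ord0 ?big_ord_recr.
apply: computablen_add; first by auto with computability.
pose fs i (w : seq nat) := if i is i'.+1 then nth 0 (drop 2 w) i' else nth 0 w 0.
apply: eq_computablen (computablen_comp (fs := fs) ch _) => [w sw|[|i] ik].
- have sd : size (drop 2 w) = k by rewrite size_drop sw subn2.
  have -> : mkseq (fs ^~ w) k.+1 = nth 0 w 0 :: drop 2 w.
    by rewrite -[in RHS](mkseq_nth 0 (drop 2 w)) sd /mkseq /= (iotaDl 1 0) -map_comp.
  by rewrite /= drop0.
- exact: computablen_nth.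
- exact: computablen_nth_drop.
Qed.

Lemma computablen_exists k f (h : nat -> seq nat -> bool) :
  computablen k f -> computablen k.+1 (fun w => h (nth 0 w 0) (drop 1 w) : nat) ->
  computablen k (fun v => [exists i : 'I_(f v), h i v] : nat).
Proof.
move=> cf ch; apply: (@eq_computablen _ (fun v => 0 < \sum_(i < f v) h i v)).
  move=> v _; congr nat_of_bool; apply/idP/existsP => [|[i hi]].
    rewrite lt0n sum_nat_eq0 => /forallPn [i].
    by rewrite negb_imply eqb0 negbK => /andP[_ hi]; exists i.
  by rewrite (bigD1 i) //= hi.
have := computablen_sum (h := fun i v => h i v : nat) cf ch.
by auto with computability.
Qed.

Lemma sum_ord_ltn n s (P : nat -> bool) :
  s <= n -> (forall i, i < n -> P i = (i < s)) -> \sum_(i < n) P i = s.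
Proof.
move=> sn Ps; rewrite (eq_bigr (fun i : 'I_n => (i < s) : nat)); last first.
  by move=> i _; rewrite Ps.
by rewrite -big_mkcond /= (big_ord_narrow sn) /= sum1_card card_ord.
Qed.

Lemma computablen_divn k f g : computablen k f -> computablen k g ->
  computablen k (fun v => f v %/ g v).
Proof.
move=> cf cg; apply: (@eq_computablen _
    (fun v => (0 < g v) * \sum_(i < f v) (i.+1 * g v <= f v))) => [v _|].
  have [->|g0] := posnP (g v); first by rewrite divn0 mul0n.
  rewrite mul1n; apply: (sum_ord_ltn (P := fun i => i.+1 * g v <= f v)) => [|i _].
    exact: leq_div.
  by rewrite leq_divRL.
apply: computablen_mul; first by auto with computability.
apply: (computablen_sum (h := fun i v => i.+1 * g v <= f v)) => //.
by auto with computability.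
Qed.
#[local] Hint Resolve computablen_divn : computability.

Lemma computablen_modn k f g : computablen k f -> computablen k g ->
  computablen k (fun v => f v %% g v).
Proof.
move=> cf cg; apply: (@eq_computablen _ (fun v => f v - f v %/ g v * g v)) => [v _|].
  by rewrite {1}(divn_eq (f v) (g v)) addKn.
by auto with computability.
Qed.
#[local] Hint Resolve computablen_modn : computability.

Definition npair (m n : nat) : nat := (m + n) ^ 2 + m.
Definition nsqrt (n : nat) : nat := \sum_(i < n) (i.+1 ^ 2 <= n).
Definition nfst (n : nat) : nat := n - nsqrt n ^ 2.
Definition nsnd (n : nat) : nat := nsqrt n - nfst n.

Lemma nsqrt_eq s n : s ^ 2 <= n < s.+1 ^ 2 -> nsqrt n = s.
Proof.
by move=> sn; apply: (sum_ord_ltn (P := fun i => i.+1 ^ 2 <= n)) => [|i _]; nia.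
Qed.

Lemma nsqrt_npair m n : nsqrt (npair m n) = m + n.
Proof. by apply: nsqrt_eq; rewrite /npair; nia. Qed.

Lemma nfst_npair m n : nfst (npair m n) = m.
Proof. by rewrite /nfst nsqrt_npair /npair addKn. Qed.

Lemma nsnd_npair m n : nsnd (npair m n) = n.
Proof. by rewrite /nsnd nfst_npair nsqrt_npair addKn. Qed.

Lemma computablen_npair k f g : computablen k f -> computablen k g ->
  computablen k (fun v => npair (f v) (g v)).
Proof. by rewrite /npair; auto with computability. Qed.

Lemma computablen_nsqrt k f : computablen k f -> computablen k (fun v => nsqrt (f v)).
Proof.
move=> cf; apply: (computablen_sum (h := fun i v => i.+1 ^ 2 <= f v)) => //.
by auto with computability.
Qed.
#[local] Hint Resolve computablen_npair computablen_nsqrt : computability.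

Lemma computablen_nfst k f : computablen k f -> computablen k (fun v => nfst (f v)).
Proof. by rewrite /nfst; auto with computability. Qed.
#[local] Hint Resolve computablen_nfst : computability.

Lemma computablen_nsnd k f : computablen k f -> computablen k (fun v => nsnd (f v)).
Proof. by rewrite /nsnd; auto with computability. Qed.
#[local] Hint Resolve computablen_nsnd : computability.

Local Open Scope classical_set_scope.
Local Open Scope ring_scope.

(** * Dyadic rationals *)

Section Dyadic.
Variable R : realType.
Implicit Types (d e m n p q : nat) (x : R).

Lemma exp2V_gt0 n : 0 < 2 ^- n :> R.
Proof. by rewrite invr_gt0 exprn_gt0. Qed.

Lemma exp2VS n : 2 ^- n = 2 ^- n.+1 + 2 ^- n.+1 :> R.
Proof. by rewrite exprS invfM; lra. Qed.

Lemma exp2V_le m n : (m <= n)%N -> 2 ^- n <= 2 ^- m :> R.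
Proof. by move=> mn; rewrite lef_pV2 ?posrE ?exprn_gt0// ler_eXn2l ?ltr1n. Qed.

Lemma exp2V_le1 n : 2 ^- n <= 1 :> R.
Proof. by have := @exp2V_le 0 n isT; rewrite expr0 invr1. Qed.

Lemma exp2V_lt x : 0 < x -> exists n, 2 ^- n < x.
Proof.
move=> x0; have [N _ Nx] := near_infty_natSinv_expn_lt (PosNum x0).
by exists N; have := Nx N (leqnn N); rewrite /= div1r.
Qed.

Lemma dyadic0 e : dyadic R 0 e = 0.
Proof. by rewrite /dyadic mul0r. Qed.

Lemma dyadic1 e : dyadic R 1 e = 2 ^- e.
Proof. by rewrite /dyadic mul1r. Qed.

Lemma dyadic_exp2 e : dyadic R (2 ^ e) e = 1.
Proof. by rewrite /dyadic natrX mulfV// expf_neq0. Qed.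

Lemma dyadicD p q e : dyadic R (p + q) e = dyadic R p e + dyadic R q e.
Proof. by rewrite /dyadic natrD mulrDl. Qed.

Lemma dyadicB p q e : (q <= p)%N -> dyadic R (p - q) e = dyadic R p e - dyadic R q e.
Proof. by move=> qp; rewrite /dyadic natrB// mulrBl. Qed.

Lemma dyadicS p e : dyadic R p.+1 e = dyadic R p e + 2 ^- e.
Proof. by rewrite -addn1 dyadicD dyadic1. Qed.

Lemma dyadic_mulexp2 p e n : dyadic R (p * 2 ^ n) (e + n) = dyadic R p e.
Proof. by rewrite /dyadic exprD natrM natrX -mulf_div mulfV ?mulr1// expf_neq0. Qed.

Lemma lt_dyadic_cross p d q e :
  (dyadic R p d < dyadic R q e) = (p * 2 ^ e < q * 2 ^ d)%N.
Proof.
rewrite -(ltr_nat R) !natrM !natrX ltr_pdivrMr ?exprn_gt0//.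
by rewrite [_ / _ * _]mulrAC ltr_pdivlMr ?exprn_gt0.
Qed.

Lemma lt_dyadic p q e : (dyadic R p e < dyadic R q e) = (p < q)%N.
Proof. by rewrite lt_dyadic_cross ltn_pmul2r ?expn_gt0. Qed.

Lemma le_dyadic p q e : (dyadic R p e <= dyadic R q e) = (p <= q)%N.
Proof. by rewrite leNgt lt_dyadic -leqNgt. Qed.

Lemma dyadic_ge0 p e : 0 <= dyadic R p e.
Proof. by rewrite divr_ge0 ?exprn_ge0. Qed.

Lemma dyadic01 p e : (p <= 2 ^ e)%N -> dyadic R p e \in `[0, 1].
Proof. by move=> pe; rewrite in_itv /= dyadic_ge0 -(dyadic_exp2 e) le_dyadic. Qed.

Lemma dyadic_truncn x n : 0 <= x ->
  dyadic R (Num.truncn (2 ^+ n * x)) n <= x < dyadic R (Num.truncn (2 ^+ n * x)).+1 n.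
Proof.
move=> x0; rewrite ler_pdivrMr ?exprn_gt0// ltr_pdivlMr ?exprn_gt0// mulrC.
by apply: truncn_itv; rewrite mulr_ge0 ?exprn_ge0.
Qed.

End Dyadic.

(** * Slopes and derivatives *)

Definition slope (K : fieldType) (f : K -> K) (x y : K) : K := (f y - f x) / (y - x).

Lemma slopeC (K : fieldType) (f : K -> K) x y : slope f x y = slope f y x.
Proof. by rewrite /slope -(opprB (f x)) -(opprB x) invrN mulrNN. Qed.

Section Derivative.
Variable R : realType.
Implicit Types (f : R -> R) (x y z d l : R).

Definition punctured_ball01 z d : set R :=
  [set y | [/\ y \in `[0, 1], y != z & `|y - z| < d]].

Lemma near_punctured01P z (P : set R) :
  (\forall y \near within [set y | y \in `[0, 1] /\ y != z] (nbhs z), P y) <->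
  exists2 d, 0 < d & punctured_ball01 z d `<=` P.
Proof.
rewrite near_withinE; split=> [/nbhs_ballP[d /= d0 dP]|[d d0 dP]].
  by exists d => // y [y01 yz yd]; apply: dP => //=; rewrite /ball /= distrC.
apply/nbhs_ballP; exists d => //= y; rewrite /ball /= distrC => yd [y01 yz].
exact: dP.
Qed.

Lemma punctured_ball01_nonempty z d :
  z \in `[0, 1] -> 0 < d -> punctured_ball01 z d !=set0.
Proof.
rewrite in_itv /= => /andP[z0 z1] d0; pose t := Num.min (d / 2) 2^-1.
have [t0 td t1] : [/\ 0 < t, t < d & t <= 2^-1].
  by rewrite /t; case: (leP (d / 2) 2^-1) => ?; split; lra.
have [zh|zh] := leP z 2^-1; [exists (z + t)|exists (z - t)];
  split; rewrite ?in_itv /=; try lra.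
- by rewrite addrC addKr gtr0_norm.
- by rewrite addrC addKr normrN gtr0_norm.
Qed.

Definition derivative01 f z l : Prop :=
  forall e, 0 < e -> exists2 d, 0 < d &
    forall y, punctured_ball01 z d y -> `|slope f z y - l| <= e.

Lemma differentiable01P f z : differentiable01 f z <-> exists l, derivative01 f z l.
Proof.
split=> -[l fl]; exists l.
  move=> e e0; move/cvgrPdist_le : fl => /(_ e e0)/near_punctured01P[d d0 fd].
  by exists d => // y /fd; rewrite distrC.
apply/cvgrPdist_le => e /fl[d d0 fd]; apply/near_punctured01P; exists d => // y /fd.
by rewrite distrC.
Qed.

Lemma cauchy_slope_differentiable01 f z : z \in `[0, 1] ->
  (forall e, 0 < e -> exists2 d, 0 < d & forall y y',
    punctured_ball01 z d y -> punctured_ball01 z d y' ->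
    `|slope f z y - slope f z y'| <= e) ->
  differentiable01 f z.
Proof.
move=> z01 f_cauchy; set F := within [set y | y \in `[0, 1] /\ y != z] (nbhs z).
have FF : ProperFilter F.
  apply: within_nbhs_proper => A zA.
  have /near_punctured01P[d d0 dA] : \forall y \near F, A y.
    by rewrite near_withinE; apply: filterS zA.
  have [y yd] := punctured_ball01_nonempty z01 d0.
  by exists y; split; [case: yd|exact: dA].
have FP := fmap_proper_filter (slope f z) FF.
suff /cauchy_cvg/cvg_ex[l fl] : cauchy (slope f z y @[y --> F]) by exists l.
apply: cauchy_exP => e e0; have [d d0 fd] := f_cauchy (e / 2) ltac:(lra).
have [y yd] := punctured_ball01_nonempty z01 d0.
exists (slope f z y); apply/near_punctured01P; exists d => // y' y'd.
by apply: (le_lt_trans (fd y y' yd y'd)); lra.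
Qed.

Lemma derivative01_chord f z l : derivative01 f z l ->
  forall e, 0 < e -> exists2 d, 0 < d &
    forall x y, x \in `[0, 1] -> y \in `[0, 1] -> x <= z <= y -> x < y ->
      y - x < d -> `|slope f x y - l| <= e.
Proof.
move=> fl e /fl[d d0 fd]; exists d => // x y x01 y01 /andP[xz zy] xy yxd.
have taylor u : u \in `[0, 1] -> `|u - z| < d ->
    `|f u - f z - l * (u - z)| <= e * `|u - z|.
  move=> u01 ud; have [->|uz] := eqVneq u z.
    by rewrite !subrr mulr0 normr0 subr0 normr0 mulr0.
  have uz0 : u - z != 0 by rewrite subr_eq0.
  have -> : f u - f z - l * (u - z) = (slope f z u - l) * (u - z).
    by rewrite mulrBl divfK.
  by rewrite normrM ler_wpM2r// fd.
have yx0 : 0 < y - x by lra.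
have -> : slope f x y - l =
    ((f y - f z - l * (y - z)) - (f x - f z - l * (x - z))) / (y - x).
  by rewrite /slope; field; rewrite gt_eqF.
rewrite normrM normfV (gtr0_norm yx0) ler_pdivrMr// (le_trans (ler_normB _ _))//.
have -> : e * (y - x) = e * `|y - z| + e * `|x - z|.
  have [yz0 xz0] : 0 <= y - z /\ x - z <= 0 by lra.
  by rewrite (ger0_norm yz0) (ler0_norm xz0); ring.
by apply: lerD; apply: taylor => //; rewrite ltr_norml; lra.
Qed.

End Derivative.

(** * Computable reals and computable functions *)

Section ComputableReals.
Variable R : realType.
Implicit Types (x z : R) (f : R -> R) (u : nat -> R).

Lemma ratr_signed_div (s a b : nat) :
  ratr ((-1) ^+ s * a%:R / b.+1%:R) = (-1) ^+ s * a%:R / b.+1%:R :> R.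
Proof.
by rewrite fmorph_div /= rmorphM /= rmorphXn /= rmorphN /= rmorph1 !ratr_nat.
Qed.

Lemma ratr_exp2V n : ratr (2 ^- n) = 2 ^- n :> R.
Proof. by rewrite fmorphV /= rmorphXn /= ratr_nat. Qed.

Lemma cauchy_name_dist (q : nat -> rat) x :
  cauchy_name q x -> forall n, `|ratr (q n) - x| <= 2 ^- n.
Proof.
move=> [qq qx] n.
have step m : `|ratr (q m.+1) - ratr (q m) : R| <= 2 ^- m.+1.
  by rewrite -rmorphB -ratr_norm -ratr_exp2V ler_rat; apply: (qq m.+1).
have tail j : `|ratr (q n) - ratr (q (n + j)%N) : R| <= 2 ^- n - 2 ^- (n + j).
  elim: j => [|j IHj]; first by rewrite addn0 !subrr normr0.
  rewrite -(subrKA (ratr (q (n + j)%N))) (le_trans (ler_normD _ _))//.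
  have := step (n + j)%N; rewrite distrC addnS.
  by move: IHj; rewrite (exp2VS R (n + j)); lra.
have qnx : `|ratr (q n) - ratr (q j)| @[j --> \oo] --> `|ratr (q n) - x|.
  by apply: cvg_norm; apply: cvgB => //; exact: cvg_cst.
apply: (cvgr_to_le qnx); exists n => // j /= nj.
by have := tail (j - n)%N; rewrite subnKC//; have := exp2V_gt0 R j; lra.
Qed.

Lemma cauchy_name_of_dist (q : nat -> rat) x :
  (forall n, `|ratr (q n) - x| <= 2 ^- n.+2) -> cauchy_name q x.
Proof.
move=> qx; split=> [n n0|].
  rewrite -(ler_rat R) ratr_exp2V ratr_norm rmorphB.
  have := qx n; have := qx n.-1; case: n n0 => // n _ /=.
  have := exp2V_gt0 R n.+3; rewrite (exp2VS R n.+1) (exp2VS R n.+2) !ler_norml; lra.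
apply/cvgrPdist_lt => e /exp2V_lt[N Ne]; exists N => // n /= Nn.
rewrite distrC; apply: le_lt_trans (qx n) _; apply: le_lt_trans Ne.
by apply: exp2V_le; lia.
Qed.

Lemma computable_realseq_of_dyadic (p e : nat -> nat -> nat) u :
  computable2 p -> computable2 e ->
  (forall k n, `|dyadic R (p k n) (e k n) - u k| <= 2 ^- n.+2) ->
  computable_realseq u.
Proof.
move=> cp ce pu; pose b k n := (2 ^ e k n).-1.
exists (fun k n => (-1) ^+ 0 * (p k n)%:R / (b k n).+1%:R); split.
  exists (fun _ _ => 0%N), p, b; split=> //; apply/computable2P;
    by rewrite /b; auto with computability.
move=> k; apply: cauchy_name_of_dist => n.
by rewrite ratr_signed_div /b prednK ?expn_gt0// expr0 mul1r natrX; exact: pu.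
Qed.

(* Truncated subtraction is harmless: the approximated quantity is >= 0. *)
Lemma computable_realseq_nat_approx u (C : nat) :
  computable_realseq u -> (forall k, 0 <= u k + C%:R) ->
  exists2 F : nat -> nat -> nat, computable2 F &
    forall k n, `|(F k n)%:R - 2 ^+ n * (u k + C%:R)| <= 2.
Proof.
move=> [q [[s [a [b [cs ca cb qE]]]] qu]] uC.
pose fl k n := ((a k n * 2 ^ n) %/ (b k n).+1)%N.
exists (fun k n => if odd (s k n) then (C * 2 ^ n - fl k n)%N
                   else (C * 2 ^ n + fl k n)%N).
  by apply/computable2P; rewrite /fl; auto 20 with computability.
move=> k n; have := cauchy_name_dist (qu k) n; rewrite qE ratr_signed_div.
move: (uC k); set w := u k + C%:R => w0.
have -> : u k = w - C%:R by rewrite /w addrK.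
set E : R := 2 ^+ n; have E0 : 0 < E by rewrite exprn_gt0.
set v : R := (a k n)%:R / (b k n).+1%:R; rewrite -mulrA -/v => vw.
have flE : (fl k n)%:R <= v * E < (fl k n)%:R + 1.
  rewrite /v /E mulrAC ler_pdivlMr ?ltr0Sn// ltr_pdivrMr ?ltr0Sn//.
  rewrite natr1 -natrX -!natrM ler_nat ltr_nat /fl leq_trunc_div /=.
  by rewrite ltn_ceil.
have {vw} : `|E * ((-1) ^+ s k n * v - (w - C%:R))| <= 1.
  rewrite normrM (gtr0_norm E0) mulrC -ler_pdivlMr// mul1r; exact: vw.
have Ew : 0 <= E * w by rewrite mulr_ge0// ltW.
rewrite -signr_odd; case: (odd (s k n)) => /=; last first.
  by rewrite expr0 mul1r natrD natrM natrX -/E !ler_norml; nra.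
rewrite expr1 mulN1r !ler_norml => vw.
have [le|lt] := leqP (fl k n) (C * 2 ^ n).
  by rewrite natrB// natrM natrX -/E; nra.
have -> : (C * 2 ^ n - fl k n)%N = 0%N by apply/eqP; rewrite subn_eq0 ltnW.
by move: lt; rewrite -(ltr_nat R) natrM natrX -/E sub0r; nra.
Qed.

Lemma computable_fun01_cvg f x : computable_fun01 f -> x \in `[0, 1] ->
  f y @[y --> within `[0, 1] (nbhs x)] --> f x.
Proof.
move=> [_ [h _ hf]] x01; apply/cvgrPdist_lt => e /exp2V_lt[n ne].
rewrite near_withinE; apply/nbhs_ballP; exists (2 ^- h n); first exact: exp2V_gt0.
by move=> y xy y01; apply: lt_trans ne; apply: hf.
Qed.

Lemma computable_fun01_cvg_seq f u x : computable_fun01 f ->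
  x \in `[0, 1] -> (forall n, u n \in `[0, 1]) ->
  u n @[n --> \oo] --> x -> f (u n) @[n --> \oo] --> f x.
Proof.
move=> cf x01 u01 ux; apply: cvg_comp (computable_fun01_cvg cf x01) => A xA.
have uA : \forall n \near \oo, u n \in `[0, 1] -> A (u n) := ux _ xA.
by apply: filterS uA => n; apply.
Qed.

Lemma computable_fun01_bounded_below f : computable_fun01 f ->
  exists C : nat, forall x, x \in `[0, 1] -> 0 <= f x + C%:R.
Proof.
move=> cf; have [|c _ fc] := @EVT_min R f 0 1 ler01.
  by apply/subspace_continuousP => x; exact: computable_fun01_cvg.
exists (Num.bound `|f c|) => x /fc.
by have := archi_boundP (normr_ge0 (f c)); rewrite ltr_norml; lra.
Qed.

End ComputableReals.

(** * Differentiability as a Pi02 condition *)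

Section DyadicChords.
Variable R : realType.
Implicit Types (f : R -> R) (F : nat -> nat -> nat) (x y z : R).
Implicit Types (C e i j k m n p q : nat).

Definition dyadic_approx f C F : Prop := forall e p, (p <= 2 ^ e)%N ->
  `|(F e p)%:R - 2 ^+ e * (f (dyadic R p e) + C%:R)| <= 2.

Lemma computable_fun01_dyadic_approx f : computable_fun01 f ->
  exists C, exists2 F, computable2 F & dyadic_approx f C F.
Proof.
move=> cf; have [C fC] := computable_fun01_bounded_below cf; exists C.
pose p k := minn (nsnd k) (2 ^ nfst k).
have p01 k : dyadic R (p k) (nfst k) \in `[0, 1] by apply: dyadic01; rewrite geq_minr.
have cp : computable_realseq (fun k => dyadic R (p k) (nfst k)).
  apply: (@computable_realseq_of_dyadic _ (fun k _ => p k) (fun k _ => nfst k)).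
  - by apply/computable2P; rewrite /p; auto with computability.
  - by apply/computable2P; auto with computability.
  - by move=> k n; rewrite subrr normr0 ltW ?exp2V_gt0.
have [F cF FE] := computable_realseq_nat_approx (cf.1 _ p01 cp) (fun k => fC _ (p01 k)).
exists (fun e p => F (npair e p) e) => [|e i ie].
  by apply/computable2P; auto with computability.
by have := FE (npair e i) e; rewrite /p nfst_npair nsnd_npair (minn_idPl ie).
Qed.

Definition chord_slope f e i j : R := slope f (dyadic R i e) (dyadic R j e).

Lemma chord_slope_refine f e i j n :
  chord_slope f (e + n) (i * 2 ^ n) (j * 2 ^ n) = chord_slope f e i j.
Proof. by rewrite /chord_slope !dyadic_mulexp2. Qed.

Lemma chord_slope_approx f C F e i j : dyadic_approx f C F -> (i < j <= 2 ^ e)%N ->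
  `|chord_slope f e i j - ((F e j)%:R - (F e i)%:R) / (j - i)%:R| <= 4 / (j - i)%:R.
Proof.
move=> FE /andP[ij je]; have ij0 : 0 < (j - i)%:R :> R by rewrite ltr0n subn_gt0.
have -> : chord_slope f e i j = (2 ^+ e * (f (dyadic R j e) + C%:R) -
    2 ^+ e * (f (dyadic R i e) + C%:R)) / (j - i)%:R.
  rewrite /chord_slope /slope -dyadicB 1?ltnW// /dyadic.
  by field; rewrite expf_neq0// gt_eqF.
rewrite -mulrBl normrM normfV (gtr0_norm ij0) ler_pM2r ?invr_gt0//.
have := FE _ _ je; have := FE _ _ (leq_trans (ltnW ij) je); rewrite !ler_norml; lra.
Qed.

(* The inequality between the approximate slopes
   (F e j - F e i) / (j - i) > (F e j' - F e i') / (j' - i') + 2^-k + errors,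
   cleared of its denominators; the summand with the factor 4 is the error bound
   of [chord_slope_approx] for both chords. *)
Definition steeper F k e i j i' j' : bool :=
  (2 ^ k * (F e i * (j' - i') + F e j' * (j - i) + 4 * ((j - i) + (j' - i'))) +
     (j - i) * (j' - i') <
   2 ^ k * (F e j * (j' - i') + F e i' * (j - i)))%N.

Lemma steeperE F k e i j i' j' : (i < j)%N -> (i' < j')%N ->
  steeper F k e i j i' j' =
  (2 ^- k + 4 / (j - i)%:R + 4 / (j' - i')%:R <
    ((F e j)%:R - (F e i)%:R) / (j - i)%:R -
    ((F e j')%:R - (F e i')%:R) / (j' - i')%:R :> R).
Proof.
move=> ij ij'; rewrite /steeper -(ltr_nat R) !(natrD, natrM, natrX).
have : 0 < (j - i)%:R :> R by rewrite ltr0n subn_gt0.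
have : 0 < (j' - i')%:R :> R by rewrite ltr0n subn_gt0.
have : 0 < 2 ^+ k :> R by rewrite exprn_gt0.
move: (2 ^+ k) (j - i)%:R (j' - i')%:R => K J J' K0 J'0 J0.
have KJ : 0 < K * (J * J') by rewrite !mulr_gt0.
rewrite -[RHS](ltr_pM2l KJ) -subr_gt0 -[RHS]subr_gt0; congr (0 < _); field.
by rewrite !gt_eqF.
Qed.

Lemma steeper_slope_gap f C F k e i j i' j' : dyadic_approx f C F ->
  (i < j <= 2 ^ e)%N -> (i' < j' <= 2 ^ e)%N -> steeper F k e i j i' j' ->
  2 ^- k < chord_slope f e i j - chord_slope f e i' j'.
Proof.
move=> FE ij ij'; rewrite steeperE; [|by case/andP: ij|by case/andP: ij'].
have := chord_slope_approx FE ij; have := chord_slope_approx FE ij'.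
by rewrite !ler_norml; lra.
Qed.

Lemma slope_gap_steeper f C F k e i j i' j' : dyadic_approx f C F ->
  (i < j <= 2 ^ e)%N -> (i' < j' <= 2 ^ e)%N ->
  2 ^- k < chord_slope f e i j - chord_slope f e i' j' ->
  exists n, steeper F k (e + n) (i * 2 ^ n) (j * 2 ^ n) (i' * 2 ^ n) (j' * 2 ^ n).
Proof.
move=> FE ij ij'; set s := _ - _ => ks; have s0 : 0 < s - 2 ^- k by lra.
have [n ns] := exp2V_lt (divr_gt0 s0 (ltr0n R 16)); exists n.
have refine p q : (p < q <= 2 ^ e)%N -> (p * 2 ^ n < q * 2 ^ n <= 2 ^ (e + n))%N.
  by rewrite expnD ltn_pmul2r ?leq_pmul2r ?expn_gt0.
have error p q : (p < q <= 2 ^ e)%N ->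
    4 / (q * 2 ^ n - p * 2 ^ n)%:R < (s - 2 ^- k) / 4 :> R.
  case/andP=> pq _; rewrite -mulnBl natrM natrX invfM.
  have : (q - p)%:R^-1 <= 1 :> R by rewrite invf_le1 ?ler1n ?ltr0n subn_gt0.
  have : 0 < (q - p)%:R^-1 :> R by rewrite invr_gt0 ltr0n subn_gt0.
  have := exp2V_gt0 R n; move: ns; nra.
rewrite steeperE; [|by case/andP: (refine _ _ ij)|by case/andP: (refine _ _ ij')].
have := chord_slope_approx FE (refine _ _ ij).
have := chord_slope_approx FE (refine _ _ ij').
have := error _ _ ij; have := error _ _ ij'.
by rewrite !chord_slope_refine !ler_norml /s; lra.
Qed.

Definition short_chord m e i j : bool :=
  [&& i < j, j <= 2 ^ e & (j - i) * 2 ^ m < 2 ^ e]%N.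

Lemma short_chordE m e i j : short_chord m e i j =
  [&& (i < j)%N, (j <= 2 ^ e)%N & dyadic R j e - dyadic R i e < 2 ^- m].
Proof.
rewrite /short_chord; have [ij|//] := ltnP i j.
by rewrite -(dyadicB _ _ (ltnW ij)) -dyadic1 lt_dyadic_cross mul1n.
Qed.

Definition straddling m z e i j : bool :=
  short_chord m e i j && (dyadic R i e < z < dyadic R j e).

Lemma straddling_refine m z e i j n :
  straddling m z (e + n) (i * 2 ^ n) (j * 2 ^ n) = straddling m z e i j.
Proof.
rewrite /straddling !short_chordE !dyadic_mulexp2 ltn_pmul2r ?expn_gt0//.
by rewrite expnD leq_pmul2r ?expn_gt0.
Qed.

Lemma straddling_lt m z e i j : straddling m z e i j -> (i < j <= 2 ^ e)%N.
Proof. by move=> /andP[/and3P[-> ->]]. Qed.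

Lemma derivative01_straddling f z l : derivative01 f z l -> forall c, 0 < c ->
  exists m, forall e i j, straddling m z e i j -> `|chord_slope f e i j - l| <= c.
Proof.
move=> fl c c0; have [d d0 fd] := derivative01_chord fl c0.
have [m md] := exp2V_lt d0; exists m => e i j /andP[+ /andP[iz zj]].
rewrite short_chordE => /and3P[ij je short].
apply: fd; rewrite ?lt_dyadic//.
- by rewrite dyadic01// ltnW// (leq_trans ij).
- exact: dyadic01.
- by rewrite !ltW.
- exact: lt_trans md.
Qed.

Definition chord_set F k m : set R :=
  [set z | exists e i j i' j', [/\ straddling m z e i j, straddling m z e i' j' &
    steeper F k e i j i' j']].

Lemma chord_set01 F k m x : chord_set F k m x -> x \in `[0, 1].
Proof.
move=> [e [i [j [_ [_ [/andP[/and3P[_ je _] /andP[ix xj]] _ _]]]]]].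
have := dyadic01 R je; rewrite !in_itv /= => /andP[_ j1].
by rewrite (le_trans (dyadic_ge0 R i e) (ltW ix)) (le_trans (ltW xj)).
Qed.

Lemma chord_set_Sigma01 F k : computable2 F -> uniformly_Sigma01 (chord_set F k).
Proof.
move=> cF; pose e K := nfst K; pose i K := nfst (nsnd K).
pose j K := nfst (nsnd (nsnd K)); pose i' K := nfst (nsnd (nsnd (nsnd K))).
pose j' K := nsnd (nsnd (nsnd (nsnd K))).
pose test m K := [&& short_chord m (e K) (i K) (j K),
  short_chord m (e K) (i' K) (j' K), (maxn (i K) (i' K) <= minn (j K) (j' K))%N &
  steeper F k (e K) (i K) (j K) (i' K) (j' K)].
exists (fun _ _ => 0%N), (fun m K => test m K * maxn (i K) (i' K))%N, (fun _ K => e K),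
  (fun m K => test m K * minn (j K) (j' K))%N, (fun _ K => e K).
split=> [|m K|m].
- split; apply/computable2P;
    rewrite /test /short_chord /steeper /e /i /j /i' /j'; by auto 20 with computability.
- rewrite dyadic_ge0 le_dyadic -(dyadic_exp2 R (e K)) le_dyadic.
  case: (boolP (test m K)) => [|_]; last by rewrite !mul0n.
  by move=> /and4P[/and3P[_ je _] _ mm _]; rewrite !mul1n geq_min je.
- apply/seteqP; split=> [x [e0 [i0 [j0 [i0' [j0' [ij ij' st]]]]]]|x [K _]] /=.
    exists (npair e0 (npair i0 (npair j0 (npair i0' j0')))) => //=.
    move: ij ij' => /andP[ij /andP[ix xj]] /andP[ij' /andP[ix' xj']].
    have mx : dyadic R (maxn i0 i0') e0 < x < dyadic R (minn j0 j0') e0.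
      by apply/andP; split; [rewrite /maxn|rewrite /minn]; case: ifP.
    have mm : (maxn i0 i0' <= minn j0 j0')%N.
      by rewrite -(le_dyadic R _ _ e0) ltW//; case/andP: mx => /lt_trans/[apply].
    rewrite in_itv /= /test /e /i /j /i' /j' !(nfst_npair, nsnd_npair) ij ij' mm st.
    by rewrite !mul1n.
  rewrite in_itv /=; case: (boolP (test m K)) => [/and4P[ij ij' _ st]|_]; last first.
    by rewrite !mul0n => /andP[/lt_trans/[apply]]; rewrite ltxx.
  rewrite !mul1n => /andP[mx xm].
  exists (e K), (i K), (j K), (i' K), (j' K); rewrite /straddling ij ij' st /=.
  by rewrite !(le_lt_trans _ mx, lt_le_trans xm) ?le_dyadic ?leq_maxl ?leq_maxr
    ?geq_minl ?geq_minr.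
Qed.

Lemma chord_set_not_differentiable f C F k z : dyadic_approx f C F ->
  (forall m, chord_set F k m z) -> ~ differentiable01 f z.
Proof.
move=> FE zF /differentiable01P[l fl].
have [m fm] := derivative01_straddling fl (divr_gt0 (exp2V_gt0 R k) (ltr0n R 2)).
have [e [i [j [i' [j' [ij ij' st]]]]]] := zF m.
have := steeper_slope_gap FE (straddling_lt ij) (straddling_lt ij') st.
by have := fm _ _ _ ij; have := fm _ _ _ ij'; rewrite !ler_norml; lra.
Qed.

Lemma not_chord_set_slope_le f C F k m z n i j i' j' : dyadic_approx f C F ->
  ~ chord_set F k m z -> straddling m z n i j -> straddling m z n i' j' ->
  chord_slope f n i j - chord_slope f n i' j' <= 2 ^- k.
Proof.
move=> FE zF ij ij'; rewrite leNgt; apply/negP => gap; apply: zF.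
have [e st] := slope_gap_steeper FE (straddling_lt ij) (straddling_lt ij') gap.
by do 5 eexists; split; [| |exact: st]; rewrite straddling_refine.
Qed.

Lemma dyadic_cvg_below u z : 0 <= u <= z -> 0 < z ->
  exists2 i : nat -> nat, forall n, dyadic R (i n) n < z &
    dyadic R (i n) n @[n --> \oo] --> u.
Proof.
move=> /andP[u0 uz] z0; pose i n := Num.truncn (2 ^+ n * u).
have iu n : dyadic R (i n) n <= u < dyadic R (i n).+1 n by exact: dyadic_truncn.
exists (fun n => (i n).-1) => [n|].
  case: (i n) (iu n) => [|p]; first by rewrite dyadic0.
  by rewrite dyadicS; have := exp2V_gt0 R n; rewrite /=; lra.
rewrite -[u]subr0; apply: (@squeeze_cvgr _ _ _ _ (fun n => u - 2 * 2 ^- n) (fun=> u)).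
- near=> n; have := exp2V_gt0 R n; case: (i n) (iu n) => [|p]; rewrite !dyadicS /=; lra.
- apply: cvgB; first exact: cvg_cst.
  have -> : (fun n => 2 * 2 ^- n) = geometric 2 2^-1 :> (nat -> R).
    by apply/funext => n; rewrite /= exprVn.
  by apply: cvg_geometric; rewrite ger0_norm ?invr_ge0//; lra.
- by rewrite subr0; exact: cvg_cst.
Unshelve. all: by end_near.
Qed.

Lemma dyadic_cvg_above v z : z <= v <= 1 -> 0 <= z < 1 ->
  exists2 j : nat -> nat, forall n, (j n <= 2 ^ n)%N /\ z < dyadic R (j n) n &
    dyadic R (j n) n @[n --> \oo] --> v.
Proof.
move=> /andP[zv v1] /andP[z0 z1].
have [||i iz iv] := @dyadic_cvg_below (1 - v) (1 - z); try lra.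
have i1 n : (i n <= 2 ^ n)%N.
  by rewrite -(le_dyadic R _ _ n) dyadic_exp2; have := iz n; lra.
have jE n : dyadic R (2 ^ n - i n) n = 1 - dyadic R (i n) n.
  by rewrite dyadicB// dyadic_exp2.
exists (fun n => 2 ^ n - i n)%N => [n|].
  by rewrite leq_subr jE; split=> //; have := iz n; lra.
have -> : v = 1 - (1 - v) by lra.
by under eq_fun do rewrite jE; apply: cvgB iv; exact: cvg_cst.
Qed.
End DyadicChords.

Section WeaklyRandomPoints.
Variable R : realType.
Implicit Types (f : R -> R) (F : nat -> nat -> nat) (x y z : R) (S : set R).

Lemma slope_cvg f (u v : nat -> R) x y : computable_fun01 f ->
  x \in `[0, 1] -> y \in `[0, 1] -> x != y ->
  (forall n, u n \in `[0, 1]) -> (forall n, v n \in `[0, 1]) ->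
  u n @[n --> \oo] --> x -> v n @[n --> \oo] --> y ->
  slope f (u n) (v n) @[n --> \oo] --> slope f x y.
Proof.
move=> cf x01 y01 xy u01 v01 ux vy; apply: cvgM.
  by apply: cvgB; apply: computable_fun01_cvg_seq.
by apply: cvgV; [rewrite subr_eq0 eq_sym|exact: cvgB].
Qed.

Lemma straddling_chords_cvg f m y z : computable_fun01 f -> 0 < z < 1 ->
  punctured_ball01 z (2 ^- m) y ->
  exists i j : nat -> nat, (\forall n \near \oo, straddling m z n (i n) (j n)) /\
    chord_slope f n (i n) (j n) @[n --> \oo] --> slope f z y.
Proof.
move=> cf /andP[z0 z1] [+ yz ym]; rewrite in_itv /= => /andP[y0 y1].
pose u := Num.min y z; pose v := Num.max y z.
have [u0 uz zv v1] : [/\ 0 <= u, u <= z, z <= v & v <= 1].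
  by rewrite /u /v; case: (ltP y z) => ?; split; lra.
have uvm : v - u < 2 ^- m.
  by move: ym; rewrite /u /v; case: (ltP y z) => ?; rewrite ltr_norml; lra.
have uv : u != v.
  by move: yz; rewrite /u /v; case: (ltP y z) => // _; rewrite eq_sym.
have <- : slope f u v = slope f z y.
  by rewrite /u /v; case: (ltP y z) => // _; exact: slopeC.
have [|//|i iz iu] := @dyadic_cvg_below R u z; first by rewrite u0.
have [||j jz jv] := @dyadic_cvg_above R v z; [by rewrite zv|by rewrite ltW|].
have i_lt_j n : (i n < j n <= 2 ^ n)%N.
  by have [-> zj] := jz n; rewrite -(lt_dyadic R _ _ n) (lt_trans (iz n) zj).
exists i, j; split.
  have : \forall n \near \oo, dyadic R (j n) n - dyadic R (i n) n < 2 ^- m.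
    by apply: cvgr_lt uvm; exact: cvgB.
  apply: filterS => n short; rewrite /straddling (short_chordE R) short.
  by have /andP[-> ->] := i_lt_j n; have [_ ->] := jz n; rewrite iz.
apply: slope_cvg => // [||n|n]; rewrite ?in_itv /=; try lra.
- by apply: dyadic01; have /andP[/ltnW ij] := i_lt_j n; exact: leq_trans.
- by apply: dyadic01; have [] := jz n.
Qed.

Lemma not_chord_set_differentiable f C F z : computable_fun01 f ->
  dyadic_approx f C F -> 0 < z < 1 ->
  (forall k, exists m, ~ chord_set F k m z) -> differentiable01 f z.
Proof.
move=> cf FE z01 zF; apply: cauchy_slope_differentiable01 => [|e e0].
  by rewrite in_itv /=; lra.
have [k ke] := exp2V_lt e0; have [m zm] := zF k.
exists (2 ^- m) => [|y y' ym y'm]; first exact: exp2V_gt0.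
have [i [j [ij fij]]] := straddling_chords_cvg cf z01 ym.
have [i' [j' [ij' fij']]] := straddling_chords_cvg cf z01 y'm.
apply: le_trans (ltW ke); apply: cvgr_to_le (cvg_norm (cvgB fij fij')) _.
near=> n; have zn : straddling m z n (i n) (j n) by near: n.
have zn' : straddling m z n (i' n) (j' n) by near: n.
have := not_chord_set_slope_le FE zm zn zn'.
by have := not_chord_set_slope_le FE zm zn' zn; rewrite /= !fctE ler_norml; lra.
Unshelve. all: by end_near.
Qed.

Lemma measurable_Pi02 S : Pi02 S -> measurable S.
Proof.
move=> [G [t [p [d [q [e [_ _ GE]]]]]] ->].
apply: bigcap_measurable => // m _; rewrite GE; apply: bigcup_measurable => k _.
by rewrite /open_interval01; case: (t m k) => [|[|[|?]]]; exact: measurable_itv.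
Qed.

Lemma Pi02_bigcap_itv (t p d q e : nat -> nat) :
  computable1 t -> computable1 p -> computable1 d -> computable1 q -> computable1 e ->
  (forall m, dyadic R (p m) (d m) <= dyadic R (q m) (e m) <= 1) ->
  Pi02 (\bigcap_m open_interval01 (t m) (dyadic R (p m) (d m)) (dyadic R (q m) (e m))).
Proof.
move=> ct cp cd cq ce pq; have computable_fst (h : nat -> nat) :
    computable1 h -> computable2 (fun m _ => h m).
  by move=> ch; apply/computable2P; auto with computability.
exists (fun m => open_interval01 (t m) (dyadic R (p m) (d m)) (dyadic R (q m) (e m)))
  => //.
exists (fun m _ => t m), (fun m _ => p m), (fun m _ => d m), (fun m _ => q m),
  (fun m _ => e m); split=> [|m _|m]; first by split; exact: computable_fst.
- by have /andP[] := pq m; rewrite dyadic_ge0.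
- by rewrite bigcup_const.
Qed.

Lemma Pi02_set0 : Pi02 [set 0 : R].
Proof.
have -> : [set 0 : R] = \bigcap_m open_interval01 1 (dyadic R 0 0) (dyadic R 1 m).
  apply/seteqP; split=> [_ -> m _|x x0] /=.
    by rewrite in_itv /= lexx dyadic1 exp2V_gt0.
  have xge0 : 0 <= x by have := x0 0%N I; rewrite /= in_itv /= => /andP[].
  apply/eqP; rewrite eq_le xge0 andbT leNgt; apply/negP => /exp2V_lt[n nx].
  have := x0 n I; rewrite /= in_itv /= dyadic1 => /andP[_ /(lt_trans nx)].
  by rewrite ltxx.
apply: Pi02_bigcap_itv => [|||||m]; try by apply/computable1P; auto with computability.
by rewrite dyadic0 dyadic1 ltW ?exp2V_gt0// exp2V_le1.
Qed.

Lemma Pi02_set1 : Pi02 [set 1 : R].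
Proof.
have dE m : dyadic R (2 ^ m - 1) m = 1 - 2 ^- m.
  by rewrite dyadicB ?expn_gt0// dyadic_exp2 dyadic1.
have -> : [set 1 : R] =
    \bigcap_m open_interval01 2 (dyadic R (2 ^ m - 1) m) (dyadic R 1 0).
  apply/seteqP; split=> [_ -> m _|x x1] /=.
    by rewrite in_itv /= lexx andbT dE; have := exp2V_gt0 R m; lra.
  have xle1 : x <= 1 by have := x1 0%N I; rewrite /= in_itv /= => /andP[].
  apply/eqP; rewrite eq_le xle1 /= leNgt; apply/negP.
  rewrite -subr_gt0 => /exp2V_lt[n nx].
  by have := x1 n I; rewrite /= in_itv /= dE => /andP[]; lra.
apply: Pi02_bigcap_itv => [|||||m]; try by apply/computable1P; auto with computability.
by rewrite dE dyadic1 expr0 invr1; have := exp2V_gt0 R m; lra.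
Qed.

Lemma weakly2random_interior z : weakly2random z -> 0 < z < 1.
Proof.
move=> [z01 z_random]; move: (z01); rewrite in_itv /= !le_eqVlt.
move=> /andP[/predU1P[z0|->] /predU1P[z1|->]] //; exfalso.
- by apply: (z_random _ Pi02_set0); rewrite ?lebesgue_measure_set1.
- by apply: (z_random _ Pi02_set0); rewrite ?lebesgue_measure_set1.
- by apply: (z_random _ Pi02_set1); rewrite ?lebesgue_measure_set1.
Qed.

Lemma weakly2random_differentiable z f : weakly2random z -> computable_fun01 f ->
  {ae lebesgue_measure, forall x : R, x \in `[0, 1] -> differentiable01 f x} ->
  differentiable01 f z.
Proof.
move=> z_random cf f_ae; have [C [F cF FE]] := computable_fun01_dyadic_approx cf.
have chord_Pi02 k : Pi02 (\bigcap_m chord_set F k m : set R).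
  by exists (chord_set F k) => //; exact: chord_set_Sigma01.
apply: (not_chord_set_differentiable cf FE (weakly2random_interior z_random)) => k.
apply/existsNP => zF; apply: (z_random.2 _ (chord_Pi02 k) _ (fun m _ => zF m)).
apply: measure_negligible; first exact: measurable_Pi02 (chord_Pi02 k).
apply: negligibleS f_ae => x xF /= fx.
apply: (chord_set_not_differentiable FE (fun m => xF m I)); apply: fx.
exact: chord_set01 (xF 0%N I).
Qed.

End WeaklyRandomPoints.

(** * Betting along the branches of the binary tree *)

Definition infinitely_often (P : pred nat) : Prop :=
  forall N, exists2 n, (N <= n)%N & P n.

Lemma not_infinitely_often P :
  ~ infinitely_often P -> exists N, forall n, (N <= n)%N -> ~~ P n.
Proof.
move=> /existsNP[N nP]; exists N => n Nn; apply/negP => Pn.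
by apply: nP; exists n.
Qed.

(* The children of the node [w] at depth [n] are the nodes [2 * w] and [2 * w + 1]
   at depth [n.+1]. *)
Definition branch (c : nat -> nat) : Prop := forall n, (c n.+1)./2 = c n.

Section Betting.
Local Open Scope nat_scope.
(* [hit m n w] is to say that the node [w] at depth [n] is seen at stage [n] to lie
   in the [m]-th set. *)
Variable hit : nat -> nat -> nat -> bool.
Implicit Types (i m n : nat) (c : nat -> nat).

Fixpoint level n w : nat :=
  if n is n'.+1 then level n' w./2 + hit (level n' w./2) n' w./2 else 0.

Definition bet n w : bool := hit (level n w) n w.

Lemma level_unroll n w i : i <= n ->
  nat_rect (fun=> nat) 0 (fun j r => r + hit r j (w %/ 2 ^ (n - j))) i =
  level i (w %/ 2 ^ (n - i)).
Proof.
elim: i => [//|i IHi] ltin; rewrite /= IHi 1?ltnW//.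
by rewrite -divn2 -divnMA -expnSr subnSK.
Qed.

Lemma computable2_bet : computable3 (fun m n w => hit m n w) ->
  computable2 (fun n w => bet n w).
Proof.
move=> c_hit; apply/computable2P; rewrite /bet.
have c_level : computablen 2 (fun v => level (nth 0 v 0) (nth 0 v 1)).
  pose step j r v : nat := r + hit r j (nth 0 v 1 %/ 2 ^ (nth 0 v 0 - j)).
  apply: eq_computablen (computablen_rec (h := step)
    (computablen_nth (isT : 0 < 2)) (computablen_cst 2 0) _) => [v _|].
    by rewrite level_unroll// subnn divn1.
  have : computablen 4 (fun w => hit (nth 0 w 1) (nth 0 w 0)
      (nth 0 (drop 2 w) 1 %/ 2 ^ (nth 0 (drop 2 w) 0 - nth 0 w 0))).
    by apply: (computablen_comp3 c_hit); auto with computability.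
  by rewrite /step; auto with computability.
by apply: (computablen_comp3 c_hit c_level); auto with computability.
Qed.

Lemma level_branch c n : branch c ->
  level n.+1 (c n.+1) = level n (c n) + bet n (c n).
Proof. by move=> cb; rewrite /= cb. Qed.

Lemma hit_below_level c m n : branch c -> m < level n (c n) ->
  exists i, hit m i (c i).
Proof.
move=> cb; elim: n => [//|n IHn]; rewrite level_branch//.
have [/IHn //|level_m] := ltnP m (level n (c n)).
case bn : (bet n (c n)) => /= m_level; last by lia.
by have -> : m = level n (c n); [lia|exists n].
Qed.

Lemma level_nondecreasing c m n : branch c -> m <= n -> level m (c m) <= level n (c n).
Proof.
move=> cb; elim: n => [|n IHn]; first by rewrite leqn0 => /eqP->.
rewrite leq_eqVlt => /predU1P[-> //|]; rewrite ltnS => /IHn.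
by rewrite level_branch//; lia.
Qed.

Lemma level_const c m n : branch c -> m <= n ->
  (forall i, m <= i < n -> ~~ bet i (c i)) -> level n (c n) = level m (c m).
Proof.
move=> cb; elim: n => [|n IHn]; first by rewrite leqn0 => /eqP->.
rewrite leq_eqVlt => /predU1P[-> //|]; rewrite ltnS => mn nb.
rewrite level_branch// (negbTE (nb n _)) ?mn ?ltnSn// addn0 IHn// => i /andP[mi li].
by apply: nb; rewrite mi ltnW.
Qed.

Lemma bets_hit c m : branch c -> infinitely_often (fun n => bet n (c n)) ->
  exists n, hit m n (c n).
Proof.
move=> cb bets; suff [n /(hit_below_level cb)] : exists n, m < level n (c n) by [].
elim: m => [|m [N mN]].
  by have [n _ bn] := bets 0; exists n.+1; rewrite level_branch// bn addn1.
have [n Nn bn] := bets N; exists n.+1; rewrite level_branch// bn addn1 ltnS.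
exact: leq_trans mN (level_nondecreasing cb Nn).
Qed.

Lemma bet_after c N : branch c ->
  (\forall n \near \oo, hit (level N (c N)) n (c n)) ->
  exists2 n, N <= n & bet n (c n).
Proof.
move=> cb [N' _ hits]; apply: contrapT => nb.
have {}nb n : N <= n -> ~~ bet n (c n).
  by move=> Nn; apply/negP => bn; apply: nb; exists n.
have Nn : N <= maxn N N' by rewrite leq_maxl.
apply: (negP (nb _ Nn)); rewrite /bet (level_const cb Nn) => [|i /andP[Ni _]].
  by apply: hits => /=; rewrite leq_maxr.
exact: nb.
Qed.

End Betting.

(** * Sums of tents over dyadic cells *)

Section Cells.
Variable R : realType.
Implicit Types (x y z : R) (n p : nat) (c : nat -> nat).

Definition in_cell n p x : bool := dyadic R p n <= x <= dyadic R p.+1 n.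
Definition cell n x : nat := Num.truncn (2 ^+ n * x).

Lemma cell_itv n x : 0 <= x -> dyadic R (cell n x) n <= x < dyadic R (cell n x).+1 n.
Proof. exact: dyadic_truncn. Qed.

Lemma in_cell_cell n x : 0 <= x -> in_cell n (cell n x) x.
Proof. by move=> /(cell_itv n)/andP[px /ltW xp]; rewrite /in_cell px. Qed.

Lemma cell_unique n p x : dyadic R p n <= x < dyadic R p.+1 n -> cell n x = p.
Proof.
rewrite ler_pdivrMr ?exprn_gt0// ltr_pdivlMr ?exprn_gt0// mulrC => px.
by apply/eqP; rewrite truncn_eq//; apply: le_trans (ler0n _ p) _; case/andP: px.
Qed.

Lemma dyadic_double p n : dyadic R p.*2 n.+1 = dyadic R p n.
Proof. by rewrite -(dyadic_mulexp2 R p n 1) expn1 muln2 addn1. Qed.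

Lemma dyadic_half_le p n : dyadic R p./2 n <= dyadic R p n.+1.
Proof. by rewrite -(dyadic_double p./2) le_dyadic; lia. Qed.

Lemma dyadic_halfS_ge p n : dyadic R p.+1 n.+1 <= dyadic R p./2.+1 n.
Proof. by rewrite -(dyadic_double p./2.+1) le_dyadic; lia. Qed.

Lemma in_cell_half n p x : in_cell n.+1 p x -> in_cell n p./2 x.
Proof.
move=> /andP[px xp]; rewrite /in_cell (le_trans (dyadic_half_le _ _) px).
exact: le_trans xp (dyadic_halfS_ge _ _).
Qed.

Lemma branch_cell x : 0 <= x -> branch (cell ^~ x).
Proof.
move=> x0 n; apply/esym/cell_unique; have /andP[px xp] := cell_itv n.+1 x0.
rewrite (le_trans (dyadic_half_le _ _) px).
exact: lt_le_trans xp (dyadic_halfS_ge _ _).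
Qed.

(* The last cell of depth [n] inside the unit interval has the number [2^n - 1],
   whereas [cell n 1 = 2^n]. *)
Lemma branch_of_unit_itv z : z \in `[0, 1] -> exists c,
  [/\ branch c, forall n, (c n < 2 ^ n)%N & forall n, in_cell n (c n) z].
Proof.
rewrite in_itv /= => /andP[z0 z1]; have last_lt n : ((2 ^ n).-1 < 2 ^ n)%N.
  by rewrite prednK ?expn_gt0.
exists (fun n => minn (cell n z) (2 ^ n).-1); split=> n.
- by have := last_lt n; rewrite -(branch_cell z0 n) expnS; lia.
- exact: leq_ltn_trans (geq_minr _ _) (last_lt n).
have /andP[pz zp] := in_cell_cell n z0; rewrite /in_cell; apply/andP; split.
  by apply: le_trans pz; rewrite le_dyadic geq_minl.
rewrite /minn; case: ltnP => // _.
by rewrite prednK ?expn_gt0// dyadic_exp2.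
Qed.

End Cells.

Section Wave.
Variables (R : realType) (b : nat -> nat -> bool).
Implicit Types (x y z d : R) (n p N M : nat) (c : nat -> nat).

Definition tent n x : R := let p := cell n x in
  (b n p)%:R * Num.min (x - dyadic R p n) (dyadic R p.+1 n - x).

Lemma tent_eq0 n x : ~~ b n (cell n x) -> tent n x = 0.
Proof. by rewrite /tent => /negbTE->; rewrite mul0r. Qed.

Lemma tent_in_cell n p x : in_cell n p x ->
  tent n x = (b n p)%:R * Num.min (x - dyadic R p n) (dyadic R p.+1 n - x).
Proof.
move=> /andP[px]; rewrite le_eqVlt => /predU1P[->|xp]; last first.
  by rewrite /tent (@cell_unique R n p) ?px.
rewrite /tent (@cell_unique R n p.+1); last by rewrite lexx lt_dyadic ltnSn.
have ge0 i : 0 <= dyadic R i.+1 n - dyadic R i n by rewrite subr_ge0 le_dyadic.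
by rewrite !subrr (min_l (ge0 _)) (min_r (ge0 _)) !mulr0.
Qed.

Lemma tent_dyadic N p n : (N <= n)%N -> tent n (dyadic R p N) = 0.
Proof.
move=> Nn; rewrite -(dyadic_mulexp2 R p N (n - N)) subnKC//.
rewrite (@tent_in_cell n (p * 2 ^ (n - N))).
  by rewrite subrr min_l ?mulr0// subr_ge0 le_dyadic leqnSn.
by rewrite /in_cell lexx le_dyadic leqnSn.
Qed.

Lemma min_dist_cell n p x : in_cell n p x ->
  0 <= Num.min (x - dyadic R p n) (dyadic R p.+1 n - x) <= 2 ^- n.+1.
Proof.
rewrite /in_cell dyadicS (exp2VS R n).
by case: (leP (x - dyadic R p n) (_ - x)) => ? ?; lra.
Qed.

Lemma tent_bound n x : 0 <= x -> 0 <= tent n x <= 2 ^- n.+1.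
Proof.
move=> x0; have := min_dist_cell (in_cell_cell n x0); have := exp2V_gt0 R n.+1.
by rewrite /tent; case: (b _ _) => /=; lra.
Qed.

Lemma tent_lipschitz n x y : 0 <= x -> 0 <= y -> `|tent n x - tent n y| <= `|x - y|.
Proof.
wlog xy : x y / x <= y => [sym x0 y0|x0 y0].
  by have [/sym|/ltW/sym] := leP x y; [|rewrite distrC (distrC x)]; apply.
rewrite (distrC x) (ger0_norm (_ : 0 <= y - x)) ?subr_ge0//.
have xp := in_cell_cell n x0; have yp := in_cell_cell n y0.
have [pq|qp|pq] := ltngtP (cell n x) (cell n y).
- have := min_dist_cell xp; have := min_dist_cell yp.
  have : dyadic R (cell n x).+1 n <= dyadic R (cell n y) n by rewrite le_dyadic.
  move: xp yp; rewrite /in_cell /tent ler_norml.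
  case: (leP (x - _) (_ - x)) => ?; case: (leP (y - _) (_ - y)) => ?;
  by case: (b _ _); case: (b _ _) => /=; lra.
- have : dyadic R (cell n y).+1 n <= dyadic R (cell n x) n by rewrite le_dyadic.
  by move: xp; have := cell_itv n y0; rewrite /in_cell; lra.
- move: xp yp; rewrite /in_cell /tent pq ler_norml.
  case: (leP (x - _) (_ - x)) => ?; case: (leP (y - _) (_ - y)) => ?;
  by case: (b _ _) => /=; lra.
Qed.

Lemma tent_half n p x : in_cell n.+1 p x ->
  tent n x = (b n p./2)%:R *
    (if odd p then dyadic R p./2.+1 n - x else x - dyadic R p./2 n).
Proof.
move=> xp; rewrite (tent_in_cell (in_cell_half xp)); congr (_ * _).
have pE : dyadic R p n.+1 = dyadic R p./2 n + (odd p)%:R * 2 ^- n.+1.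
  rewrite -(dyadic_double R p./2) -[in LHS](odd_double_half p) addnC dyadicD.
  by case: (odd p); rewrite ?dyadic1 ?dyadic0 ?mul1r ?mul0r.
move: xp; rewrite /in_cell !dyadicS pE (exp2VS R n).
by case: (odd p) => /=; case: (leP (x - _) (_ - x)) => ? ?; lra.
Qed.

Lemma tent_half_affine n p x y : in_cell n.+1 p x -> in_cell n.+1 p y ->
  tent n x - tent n y = (-1) ^+ odd p * (b n p./2)%:R * (x - y).
Proof.
by move=> xp yp; rewrite (tent_half xp) (tent_half yp); case: (odd p) => /=; ring.
Qed.

Definition tent_sum N x : R := \sum_(n < N) tent n x.

Lemma tent_sumS N x : tent_sum N.+1 x = tent_sum N x + tent N x.
Proof. by rewrite /tent_sum big_ord_recr. Qed.

Fixpoint wave_slope n p : R :=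
  if n is n'.+1 then wave_slope n' p./2 + (-1) ^+ odd p * (b n' p./2)%:R else 0.

Lemma tent_sum_affine n p x y : in_cell n p x -> in_cell n p y ->
  tent_sum n x - tent_sum n y = wave_slope n p * (x - y).
Proof.
elim: n p => [|n IHn] p xp yp; first by rewrite /tent_sum !big_ord0 subrr mul0r.
rewrite !tent_sumS opprD addrACA (tent_half_affine xp yp) (IHn p./2) ?in_cell_half//.
by rewrite -mulrDl.
Qed.

Lemma tent_sum_tail N i x : 0 <= x ->
  tent_sum N x <= tent_sum (N + i) x <= tent_sum N x + 2 ^- N - 2 ^- (N + i).
Proof.
move=> x0; elim: i => [|i IHi]; first by rewrite addn0; lra.
have := tent_bound (N + i) x0; move: IHi; rewrite addnS tent_sumS.
by rewrite (exp2VS R (N + i)); lra.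
Qed.

Lemma tent_sum_lipschitz N x y : 0 <= x -> 0 <= y ->
  `|tent_sum N x - tent_sum N y| <= N%:R * `|x - y|.
Proof.
move=> x0 y0; elim: N => [|N IHN].
  by rewrite /tent_sum !big_ord0 subrr normr0 mul0r.
rewrite !tent_sumS opprD addrACA -natr1 mulrDl mul1r (le_trans (ler_normD _ _))//.
by rewrite lerD// tent_lipschitz.
Qed.

Definition wave x : R := sup (range (tent_sum ^~ x)).

Lemma wave_bounds N x : 0 <= x -> tent_sum N x <= wave x <= tent_sum N x + 2 ^- N.
Proof.
move=> x0.
have ub : ubound (range (tent_sum ^~ x)) (tent_sum N x + 2 ^- N).
  move=> _ [n _ <-]; have [Nn|/ltnW nN] := leqP N n.
    have := tent_sum_tail N (n - N) x0; rewrite subnKC//.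
    by have := exp2V_gt0 R n; lra.
  have := tent_sum_tail n (N - n) x0; rewrite subnKC//.
  by have := exp2V_gt0 R N; lra.
apply/andP; split; last by apply: ge_sup => //; exists (tent_sum N x); exists N.
by apply: ub_le_sup; [exists (tent_sum N x + 2 ^- N)|exists N].
Qed.

Lemma wave_stationary N x : 0 <= x -> (forall n, (N <= n)%N -> tent n x = 0) ->
  wave x = tent_sum N x.
Proof.
move=> x0 tent0.
have stationary i : tent_sum (N + i) x = tent_sum N x.
  by elim: i => [|i IHi]; rewrite ?addn0// addnS tent_sumS IHi tent0 ?leq_addr ?addr0.
have /andP[le_wave _] := wave_bounds N x0.
apply/eqP; rewrite eq_le le_wave andbT leNgt; apply/negP.
rewrite -subr_gt0 => /exp2V_lt[n ne].
have := wave_bounds (N + n) x0; rewrite stationary.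
by have := @exp2V_le R _ _ (leq_addl N n); lra.
Qed.

Lemma wave_dyadic N p : wave (dyadic R p N) = tent_sum N (dyadic R p N).
Proof. by apply: wave_stationary (dyadic_ge0 _ _ _) _ => n; exact: tent_dyadic. Qed.

Lemma slope_wave_cell n p :
  slope wave (dyadic R p n) (dyadic R p.+1 n) = wave_slope n p.
Proof.
have lt : dyadic R p n < dyadic R p.+1 n by rewrite lt_dyadic.
rewrite /slope !wave_dyadic (@tent_sum_affine n p) ?/in_cell ?lexx ?(ltW lt)//.
by rewrite mulfK// subr_eq0 gt_eqF.
Qed.

Definition first_bet N x n : Prop :=
  [/\ (N <= n)%N, forall i, (N <= i < n)%N -> ~~ b i (cell i x) & b n (cell n x)].

Lemma wave_le_first_bet N x d : 0 <= x -> 0 <= d ->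
  (forall n, first_bet N x n -> 2 ^- n <= d) -> wave x <= tent_sum N x + d.
Proof.
move=> x0 d0 first_le.
have [bets|no_bet] := pselect (exists n, (N <= n)%N && b n (cell n x)); last first.
  rewrite (@wave_stationary N)// ?lerDl// => n Nn; apply/tent_eq0/negP => bn.
  by apply: no_bet; exists n; rewrite Nn.
case: (ex_minnP bets) => n /andP[Nn bn] n_min.
have no_earlier i : (N <= i < n)%N -> ~~ b i (cell i x).
  move=> /andP[Ni ltin]; apply/negP => bi; have := n_min i.
  by rewrite Ni bi leqNgt ltin => /(_ isT).
have <- : tent_sum n x = tent_sum N x.
  rewrite /tent_sum -!(big_mkord xpredT (tent ^~ x)) (big_cat_nat (leq0n N) Nn)/=.
  rewrite [X in _ + X]big1_seq ?addr0// => i /andP[_]; rewrite mem_index_iota.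
  by move/no_earlier/tent_eq0.
have /andP[_ /le_trans] := wave_bounds n x0; apply.
by rewrite lerD2l first_le.
Qed.

Lemma wave_modulus M x y : 0 <= x -> 0 <= y ->
  `|wave x - wave y| <= M%:R * `|x - y| + 2 ^- M.
Proof.
move=> x0 y0; have := tent_sum_lipschitz M x0 y0.
by have := wave_bounds M x0; have := wave_bounds M y0; rewrite !ler_norml; lra.
Qed.

Lemma wave_modulus_exp2 M x y : 0 <= x -> 0 <= y ->
  `|x - y| <= 2 * 2 ^- (2 * M) -> `|wave x - wave y| <= 2 * 2 ^- M.
Proof.
move=> x0 y0 xy; apply: le_trans (wave_modulus M x0 y0) _.
rewrite [leRHS](_ : _ = 2 ^- M + 2 ^- M) ?lerD2r; last by ring.
apply: le_trans (ler_wpM2l (ler0n _ M) xy) _.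
have M_exp2 : (M * 2 <= 2 ^ M)%N.
  by case: M {xy} => // M; rewrite expnS mulnC leq_mul2l ltn_expl.
rewrite mulrA -natrM mul2n -addnn exprD invfM mulrA ger_pMl ?exp2V_gt0//.
by rewrite ler_pdivrMr ?exprn_gt0// mul1r -natrX ler_nat.
Qed.

Lemma wave_not_differentiable c z : branch c -> (forall n, (c n < 2 ^ n)%N) ->
  (forall n, in_cell n (c n) z) -> infinitely_often (fun n => b n (c n)) ->
  ~ differentiable01 wave z.
Proof.
move=> cb c_lt zc bets /differentiable01P[l /derivative01_chord wave_l].
have [d d0 wave_d] := wave_l 4^-1 ltac:(lra).
have [N Nd] := exp2V_lt d0.
have slope_near n : (N <= n)%N -> `|wave_slope n (c n) - l| <= 4^-1.
  move=> Nn; rewrite -slope_wave_cell.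
  apply: wave_d; [exact/dyadic01/ltnW|exact: dyadic01|exact: zc|by rewrite lt_dyadic|].
  by rewrite dyadicS addrC addKr; apply: le_lt_trans Nd; exact: exp2V_le.
have [n Nn bn] := bets N.
have : `|wave_slope n.+1 (c n.+1) - wave_slope n (c n)| <= 2^-1.
  have := slope_near _ Nn; have := slope_near _ (leqW Nn).
  by rewrite !ler_norml; lra.
by rewrite /= cb bn addrC addKr mulr1 normr_sign; lra.
Qed.

Definition first_bets_far N x : Prop :=
  forall y n, 0 <= y -> cell N y = cell N x -> first_bet N y n ->
    dyadic R n.+1 n <= `|y - x|.

Lemma first_bets_far_wave_le N M x y : first_bets_far N x -> 0 <= y ->
  cell N y = cell N x -> `|y - x| < 2 ^- M ->
  wave y <= tent_sum N y + `|y - x| / M.+1%:R.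
Proof.
move=> far y0 yN yM; apply: wave_le_first_bet => // n /(far y n y0 yN) yn.
have Mn : (M <= n)%N.
  rewrite leqNgt; apply/negP => /ltnW/(@exp2V_le R); apply/negP; rewrite -ltNge.
  apply: le_lt_trans yM; apply: le_trans yn.
  by rewrite dyadicS; have := dyadic_ge0 R n n; lra.
rewrite ler_pdivlMr// (le_trans _ yn)// /dyadic mulrC ler_pM2r ?exp2V_gt0//.
by rewrite ler_nat.
Qed.

Lemma wave_differentiable N x : 0 <= x -> (forall n p, x != dyadic R p n) ->
  first_bets_far N x -> differentiable01 wave x.
Proof.
move=> x0 x_ndyadic far; have tent_le_wave y : 0 <= y -> tent_sum N y <= wave y.
  by move=> /(wave_bounds N)/andP[].
have wave_x : wave x = tent_sum N x.
  apply/le_anti; rewrite tent_le_wave// andbT.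
  have := @first_bets_far_wave_le N 0 x x far x0 erefl.
  by rewrite subrr normr0 mul0r addr0; apply; exact: exp2V_gt0.
have /andP[px xp] := cell_itv N x0; set p := cell N x in px xp.
apply/differentiable01P; exists (wave_slope N p) => e e0.
have [M Me] : exists M, M.+1%:R^-1 < e.
  by have [M _ /(_ M (leqnn M))] := near_infty_natSinv_lt (PosNum e0); exists M.
have {}px : dyadic R p N < x by rewrite lt_neqAle eq_sym x_ndyadic.
exists (Num.min (2 ^- M) (Num.min (x - dyadic R p N) (dyadic R p.+1 N - x))).
  by rewrite !lt_min exp2V_gt0 !subr_gt0 px.
move=> y [+ yx]; rewrite in_itv /= => /andP[y0 _].
rewrite !lt_min => /and3P[yM ypx yxp].
have yp : dyadic R p N <= y < dyadic R p.+1 N.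
  by move: ypx yxp; rewrite !ltr_norml; lra.
have wave_y := first_bets_far_wave_le far y0 (cell_unique yp) yM.
have yx0 : y - x != 0 by rewrite subr_eq0.
have -> : slope wave x y - wave_slope N p = (wave y - tent_sum N y) / (y - x).
  have affine : tent_sum N y - tent_sum N x = wave_slope N p * (y - x).
    by apply: tent_sum_affine; rewrite /in_cell ?(ltW px) ?(ltW xp)//; lra.
  by rewrite /slope wave_x -[wave_slope N p](mulfK yx0) -affine; field.
rewrite normrM normfV ger0_norm ?subr_ge0 ?tent_le_wave// (le_trans _ (ltW Me))//.
by rewrite ler_pdivrMr ?normr_gt0// mulrC lerBlDl.
Qed.

Definition wave_nat M j : nat := (\sum_(n < M) b n (j %/ 2 ^ (M - n)) *
  minn (j %% 2 ^ (M - n)) (2 ^ (M - n) - j %% 2 ^ (M - n)))%N.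

Lemma wave_natE M j : wave (dyadic R j M) = dyadic R (wave_nat M j) M.
Proof.
rewrite wave_dyadic /tent_sum /wave_nat /dyadic natr_sum mulr_suml.
apply: eq_bigr => n _; rewrite -!/(dyadic _ _ _).
set D := (2 ^ (M - n))%N; have D0 : (0 < D)%N by rewrite expn_gt0.
have dE p : dyadic R p n = dyadic R (p * D) M.
  by rewrite -(dyadic_mulexp2 R p n (M - n)) subnKC// ltnW.
have lo : (j %/ D * D <= j)%N by exact: leq_trunc_div.
have hi : (j <= (j %/ D).+1 * D)%N by rewrite ltnW// ltn_ceil.
rewrite (@tent_in_cell n (j %/ D)); last by rewrite /in_cell !dE !le_dyadic lo.
rewrite !dE -!dyadicB// [RHS]/dyadic natrM -mulrA -[_%:R / 2 ^+ M]/(dyadic R _ _).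
have -> : ((j %/ D).+1 * D - j = D - j %% D)%N by have := divn_eq j D; lia.
have -> : (j - j %/ D * D = j %% D)%N by have := divn_eq j D; lia.
congr (_ * _); have [le|/ltnW le] := leqP (j %% D) (D - j %% D).
  by rewrite min_l ?le_dyadic.
by rewrite min_r ?le_dyadic.
Qed.

Lemma computable2_wave_nat : computable2 (fun n p => b n p) -> computable2 wave_nat.
Proof.
move=> cb; apply/computable2P; rewrite /wave_nat.
apply: (computablen_sum (h := fun n v =>
  b n (nth 0 v 1 %/ 2 ^ (nth 0 v 0 - n)) *
  minn (nth 0 v 1 %% 2 ^ (nth 0 v 0 - n))
       (2 ^ (nth 0 v 0 - n) - nth 0 v 1 %% 2 ^ (nth 0 v 0 - n)))%N).
  by auto with computability.
apply: computablen_mul; last by auto 20 with computability.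
by apply: (computablen_comp2 cb); auto with computability.
Qed.

Lemma computable_fun01_wave : computable2 (fun n p => b n p) -> computable_fun01 wave.
Proof.
move=> /computable2_wave_nat c_wave.
have ge0 x : x \in `[0, 1] -> 0 <= x by rewrite in_itv => /andP[].
split=> [x x01 cx|].
  have x_ge0 k : 0 <= x k + 0%:R by rewrite addr0 ge0.
  have [J cJ JE] := computable_realseq_nat_approx cx x_ge0.
  pose depth n := (2 * (n + 3))%N.
  apply: (@computable_realseq_of_dyadic _
    (fun k n => wave_nat (depth n) (J k (depth n))) (fun _ n => depth n)) => [||k n].
  - by apply/computable2P; rewrite /depth; auto 20 with computability.
  - by apply/computable2P; rewrite /depth; auto with computability.
  have -> : 2 ^- n.+2 = 2 * 2 ^- (n + 3) :> R by rewrite (exp2VS R n.+2) addn3; ring.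
  rewrite -wave_natE; apply: wave_modulus_exp2; [exact: dyadic_ge0|exact: ge0|].
  have E0 : 0 < 2 ^+ depth n :> R by rewrite exprn_gt0.
  have -> : dyadic R (J k (depth n)) (depth n) - x k =
      ((J k (depth n))%:R - 2 ^+ depth n * x k) / 2 ^+ depth n.
    by rewrite /dyadic mulrBl [_ * x k]mulrC mulfK// gt_eqF.
  rewrite normrM normfV (gtr0_norm E0) ler_pM2r ?invr_gt0//.
  by have := JE k (depth n); rewrite addr0.
exists (fun n => 2 * (n + 2))%N.
  by apply/computable1P; auto with computability.
move=> n x y /ge0 x0 /ge0 y0 xy; have := exp2V_gt0 R (n + 2).
have : `|wave x - wave y| <= 2 * 2 ^- (n + 2).
  by apply: wave_modulus_exp2 => //; have := exp2V_gt0 R (2 * (n + 2)); lra.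
by rewrite addn2 (exp2VS R n) (exp2VS R n.+1); lra.
Qed.

End Wave.

(** * The function attached to a Pi02 set *)

Section Recognizers.
Variable R : realType.
Implicit Types (x y : R) (G : nat -> set R) (hit : nat -> nat -> nat -> bool).

(* The margin (n + 1) / 2^n tends to 0, so that every point of [G m] is eventually
   recognized, but more slowly than the height of the tents over the cells of
   depth [n]. *)
Definition cell_recognizer hit G : Prop :=
  (forall m n w x y, hit m n w -> in_cell n w y -> x \in `[0, 1] ->
     `|y - x| <= dyadic R n.+1 n -> G m x) /\
  (forall m (c : nat -> nat) x, (forall n, in_cell n (c n) x) -> x \in `[0, 1] ->
     G m x -> \forall n \near \oo, hit m n (c n)).

(* Both sides are false when [c < m], where the subtraction on the right truncates. *)
Lemma lt_dyadicB p d c m n :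
  (dyadic R p d < dyadic R c n - dyadic R m n) = (p * 2 ^ n < (c - m) * 2 ^ d)%N.
Proof.
have [mc|cm] := leqP m c; first by rewrite -dyadicB// lt_dyadic_cross.
rewrite (eqP (ltnW cm)) mul0n ltn0; apply/negbTE; rewrite -leNgt.
by rewrite (le_trans _ (dyadic_ge0 R p d))// subr_le0 le_dyadic ltnW.
Qed.

Lemma lt_dyadicD q e c m n :
  (dyadic R c n + dyadic R m n < dyadic R q e) = ((c + m) * 2 ^ e < q * 2 ^ n)%N.
Proof. by rewrite -dyadicD lt_dyadic_cross. Qed.

Lemma near_dyadic_addn2_lt x : 0 < x -> \forall n \near \oo, dyadic R n.+2 n < x.
Proof.
move=> x0; have [N _ Nx] := near_infty_natSinv_lt (PosNum (divr_gt0 x0 (ltr0n R 3))).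
exists N => // n /= /Nx /=; rewrite ltr_pdivlMr// mulrC; apply: le_lt_trans.
have : (n.+2 * n.+1 <= 3 * 2 ^ n)%N by elim: n => // -[|n] // IHn; rewrite expnS; lia.
rewrite -(ler_nat R) !natrM natrX => n_exp2.
by rewrite /dyadic ler_pdivrMr ?exprn_gt0// mulrAC ler_pdivlMr.
Qed.

Section Intervals.
Variables (t p d q e : nat).
Local Notation I := (open_interval01 t (dyadic R p d) (dyadic R q e)).

Definition cell_test n w : bool :=
  ([|| 2 < t, 0 < t <= 1 | p * 2 ^ n < (w - n.+1) * 2 ^ d] &&
   ((1 < t) || ((w.+1 + n.+1) * 2 ^ e < q * 2 ^ n)))%N.

Lemma cell_testE n w : cell_test n w =
  [|| (2 < t)%N, (0 < t <= 1)%N | dyadic R p d < dyadic R w n - dyadic R n.+1 n] &&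
  ((1 < t)%N || (dyadic R w.+1 n + dyadic R n.+1 n < dyadic R q e)).
Proof. by rewrite lt_dyadicB lt_dyadicD. Qed.

Lemma cell_test_sound n w x y : cell_test n w -> in_cell n w y ->
  x \in `[0, 1] -> `|y - x| <= dyadic R n.+1 n -> I x.
Proof.
rewrite cell_testE /in_cell ler_norml in_itv /=.
by case: t => [|[|[|t']]] /=; rewrite in_itv /=; lra.
Qed.

Lemma cell_test_complete (c : nat -> nat) x : (forall n, in_cell n (c n) x) ->
  x \in `[0, 1] -> I x -> \forall n \near \oo, cell_test n (c n).
Proof.
move=> xc x01; have left_end : dyadic R p d < x ->
    \forall n \near \oo, dyadic R p d < dyadic R (c n) n - dyadic R n.+1 n.
  rewrite -subr_gt0 => /near_dyadic_addn2_lt; apply: filterS => n.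
  by have := xc n; rewrite /in_cell !dyadicS; lra.
have right_end : x < dyadic R q e ->
    \forall n \near \oo, dyadic R (c n).+1 n + dyadic R n.+1 n < dyadic R q e.
  rewrite -subr_gt0 => /near_dyadic_addn2_lt; apply: filterS => n.
  by have := xc n; rewrite /in_cell !dyadicS; lra.
under eq_near do rewrite cell_testE.
case: t => [|[|[|t']]] /=; rewrite in_itv /=.
- by move=> /andP[/left_end + /right_end]; apply: filterS2 => n -> ->.
- by move=> /andP[_ /right_end]; apply: filterS => n ->.
- by move=> /andP[/left_end + _]; apply: filterS => n ->.
- by move=> _; exact: nearW.
Qed.

End Intervals.

Lemma Sigma01_cell_recognizer G : uniformly_Sigma01 G ->
  exists2 hit : nat -> nat -> nat -> bool,
    computable3 (fun m n w => hit m n w) & cell_recognizer hit G.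
Proof.
move=> [t [p [d [q [e [[ct cp cd cq ce] _ GE]]]]]].
pose test m k := cell_test (t m k) (p m k) (d m k) (q m k) (e m k).
exists (fun m n w => [exists k : 'I_n, test m k n w]).
  apply: (computablen_exists
    (h := fun k v => test (nth 0%N v 0) k (nth 0%N v 1) (nth 0%N v 2))).
    exact: computablen_nth.
  by rewrite /test /cell_test; auto 20 with computability.
split=> [m n w x y /existsP[k k_test] wy x01 yx|m c x xc x01].
  by rewrite GE; exists k => //; exact: cell_test_sound k_test wy x01 yx.
rewrite GE => -[k _ /(cell_test_complete xc x01)] k_test.
apply: filterS2 (nbhs_infty_gt k) k_test => n kn test_n.
by apply/existsP; exists (Ordinal kn).
Qed.

Section BettingWave.
Variables (hit : nat -> nat -> nat -> bool) (G : nat -> set R).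
Hypothesis hitG : cell_recognizer hit G.

Lemma bets_wave_not_differentiable z : z \in `[0, 1] -> (forall m, G m z) ->
  ~ differentiable01 (wave (bet hit)) z.
Proof.
move=> z01 zG; have [c [cb c_lt zc]] := branch_of_unit_itv z01.
apply: (wave_not_differentiable cb c_lt zc) => N.
by apply: bet_after cb _; exact: hitG.2.
Qed.

Lemma bets_wave_differentiable x : x \in `[0, 1] -> (forall n p, x != dyadic R p n) ->
  ~ (forall m, G m x) -> differentiable01 (wave (bet hit)) x.
Proof.
move=> x01 x_ndyadic /existsNP[m xm].
have x0 : 0 <= x by move: x01; rewrite in_itv => /andP[].
have xb := branch_cell x0; have xc n := in_cell_cell n x0.
have /not_infinitely_often[N no_bet] :
    ~ infinitely_often (fun n => bet hit n (cell n x)).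
  move=> /(bets_hit m xb)[n hit_n]; apply: xm; apply: hitG.1 hit_n (xc n) x01 _.
  by rewrite subrr normr0 dyadic_ge0.
have xG : ~ G (level hit N (cell N x)) x.
  by move=> /(hitG.2 _ _ _ xc x01)/(bet_after xb)[n /no_bet/negP].
apply: (wave_differentiable (N := N)) => // y n y0 yN [Nn no_earlier bn].
rewrite leNgt; apply/negP => /ltW near_x; apply: xG.
have level_y := level_const (branch_cell y0) Nn no_earlier.
move: bn; rewrite /bet {}level_y yN => hit_n.
exact: hitG.1 hit_n (in_cell_cell n y0) x01 near_x.
Qed.

End BettingWave.

Lemma negligible_dyadics :
  lebesgue_measure.-negligible [set x : R | exists n p, x = dyadic R p n].
Proof.
have dyadics_countable : countable [set x : R | exists n p, x = dyadic R p n].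
  have : countable (range (fun np : nat * nat => dyadic R np.2 np.1)).
    by apply: card_le_trans (card_image_le _ _) _; exact: countableP.
  by apply: sub_countable; apply: subset_card_le => x [n [p ->]]; exists (n, p).
apply/negligibleP; first exact: countable_measurable.
exact: countable_lebesgue_measure0.
Qed.

Lemma differentiable_weakly2random z : z \in `[0, 1] ->
  (forall f : R -> R, computable_fun01 f ->
     {ae lebesgue_measure, forall x : R, x \in `[0, 1] -> differentiable01 f x} ->
     differentiable01 f z) -> weakly2random z.
Proof.
move=> z01 z_diff; split=> // S PS S0 Sz.
have SN : lebesgue_measure.-negligible S.
  by apply/negligibleP => //; exact: measurable_Pi02.
have [G /Sigma01_cell_recognizer[hit c_hit hitG] SE] := PS.
apply: (bets_wave_not_differentiable hitG z01) => [m|].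
  by move: Sz; rewrite SE; apply.
apply: z_diff; first exact/computable_fun01_wave/computable2_bet.
apply: negligibleS (negligibleU SN negligible_dyadics) => x /=.
move=> /not_implyP[x01 nd]; apply: contrapT => /not_orP[xS x_ndyadic]; apply: nd.
apply: (bets_wave_differentiable hitG x01) => [n p|xG].
  by apply/eqP => xE; apply: x_ndyadic; exists n, p.
by apply: xS; rewrite SE => m _.
Qed.

End Recognizers.

Theorem theorem5p1 (R : realType) (z : R) (hz : z \in `[0, 1]) :
  weakly2random z <->
  (forall f : R -> R, computable_fun01 f ->
     {ae lebesgue_measure, forall x : R, x \in `[0, 1] -> differentiable01 f x} ->
     differentiable01 f z).
Proof.
split=> [z_random f|]; first exact: weakly2random_differentiable.
exact: differentiable_weakly2random.
Qed.
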